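(* Fix $d \geq 1$ and integers $2 \leq r_1 \leq r_2 \leq \cdots \leq r_d$. Let $\mathbf H_n = (H_n^{(1)}, \ldots, H_n^{(d)})$, $n\ge1$, be a sequence of $d$-hypermultiplexes, where $H_n^{(i)}$ is $r_i$-uniform for $1 \leq i \leq d$. Suppose the vertices of $\mathbf H_n$ are colored uniformly at random with $c_n$ colors, where $c_n\to\infty$, such that the following hold: (a) for each $1 \leq i \leq d$, $\lim_{n \to \infty}\mathbb{E}\,T(H_n^{(i)}) = \lim_{n \to \infty}\mathrm{Var}\,T(H_n^{(i)}) = \lambda_i$ for some constant $\lambda_i \geq 0$; (b) for all $1 \leq i \ne j \leq d$, $E(H_n^{(i)}) \cap E(H_n^{(j)}) = \emptyset$. Then, as $n \to \infty$, the random vector $(T(H_n^{(1)}), \ldots, T(H_n^{(d)}))^\top$ converges in distribution to $(Z_1, \ldots, Z_d)^\top$, where $Z_1\sim \mathrm{Pois}(\lambda_1), \ldots, Z_d \sim \mathrm{Pois}(\lambda_d)$ are independent.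
   Context: An $r$-uniform hypergraph $H=(V(H),E(H))$ consists of a finite vertex set $V(H)$ and a set $E(H)$ of $r$-element subsets of $V(H)$, called hyperedges. A $d$-hypermultiplex (also called a $d$-layered multiplex hypergraph) is a tuple $\mathbf H_n=(H_n^{(1)},\dots,H_n^{(d)})$ of uniform hypergraphs with a common vertex set $V_n$. ''Colored uniformly at random with $c_n$ colors'' means each $v\in V_n$ gets a color $X_v$ uniform on $\{1,\dots,c_n\}$, independently over the vertices (a single coloring is used for all layers). $T(H_n^{(i)})=\sum_{e\in E(H_n^{(i)})}\mathbf 1\{X_v=X_{v'}\ \forall v,v'\in e\}$ is the number of monochromatic hyperedges of $H_n^{(i)}$. $\mathrm{Pois}(0)$ is the point mass at $0$. *)

(* Defs.v *)
From mathcomp Require Import all_boot all_order all_algebra.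
From mathcomp Require Import all_classical all_reals all_analysis.

Set Implicit Arguments.
Unset Strict Implicit.
Unset Printing Implicit Defensive.

Import Order.TTheory GRing.Theory Num.Theory.
Import numFieldNormedType.Exports.

Local Open Scope classical_set_scope.
Local Open Scope ring_scope.

(* A hypergraph on V is identified with its set of hyperedges; the layers of a
   d-hypermultiplex share the vertex set because they share the type V. *)
Definition hypergraph (V : finType) : Type := {set {set V}}.

Definition hypermultiplex (d : nat) (V : finType) : Type :=
  'I_d -> hypergraph V.

Definition uniform_hypergraph (V : finType) (r : nat) (H : hypergraph V) : Prop :=
  forall e : {set V}, e \in H -> #|e| = r.

Definition monochromatic (V : finType) (x : V -> nat) (e : {set V}) : bool :=
  [forall v in e, forall w in e, x v == x w].

Definition num_monochromatic (V : finType) (H : hypergraph V) (x : V -> nat) : nat :=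
  (\sum_(e in (H : {set {set V}})) monochromatic x e)%N.

Definition mutually_independent (d d' : measure_display) (Omega : measurableType d)
    (S : measurableType d') (R : realType) (P : probability Omega R)
    (I : finType) (X : I -> {RV P >-> S}) : Prop :=
  forall (J : {set I}) (A : I -> set S),
    (forall i, i \in J -> measurable (A i)) ->
    P [set w | forall i, i \in J -> A i (X i w)] =
    (\prod_(i in J) P (X i @^-1` A i))%E.

(* The uniform law on {1, ..., c}. *)
Definition uniform_color (d : measure_display) (Omega : measurableType d)
    (R : realType) (P : probability Omega R) (c : nat)
    (X : {RV P >-> nat}) : Prop :=
  forall k : nat,
    distribution P X [set k] = (if (0 < k <= c)%N then (c%:R^-1 : R) else 0)%:E.

Definition uniform_coloring (d : measure_display) (Omega : measurableType d)
    (R : realType) (P : probability Omega R) (V : finType) (c : nat)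
    (X : V -> {RV P >-> nat}) : Prop :=
  (forall v, uniform_color c (X v)) /\ mutually_independent X.

(* T(H) as a real random variable, under the random coloring X. *)
Definition mono_count (d : measure_display) (Omega : measurableType d)
    (R : realType) (P : probability Omega R) (V : finType)
    (X : V -> {RV P >-> nat}) (H : hypergraph V) : Omega -> R :=
  fun w => (num_monochromatic H (fun v => X v w))%:R.

(* [poisson_prob l k] ignores its argument [k], and is the point mass at 0 when
   [l] is 0. *)
Definition poisson_distributed (d : measure_display) (Omega : measurableType d)
    (R : realType) (P : probability Omega R) (l : R)
    (Z : {RV P >-> nat}) : Prop :=
  forall A : set nat, distribution P Z A = poisson_prob l 0%N A.

(* Convergence in distribution of random vectors of R^m, through bounded
   continuous test functions; the sample space may vary with n. *)
Definition cvg_in_distribution (R : realType) (m : nat)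
    (d : nat -> measure_display) (Omega : forall n, measurableType (d n))
    (P : forall n, probability (Omega n) R) (Y : forall n, Omega n -> 'cV[R]_m)
    (d' : measure_display) (Omega' : measurableType d')
    (Q : probability Omega' R) (Z : Omega' -> 'cV[R]_m) : Prop :=
  forall f : 'cV[R]_m -> R, continuous f -> bounded_fun f ->
    ('E_(P n)[f \o Y n] @[n --> \oo] --> 'E_Q[f \o Z])%E.

(* Main.v *)
Require Import Defs.
From mathcomp Require Import all_boot all_order all_algebra.
From mathcomp Require Import all_classical all_reals all_analysis.
From mathcomp Require Import measurable_realfun zify lra ring.

Set Implicit Arguments.
Unset Strict Implicit.
Unset Printing Implicit Defensive.

Import Order.TTheory GRing.Theory Num.Theory.
Import numFieldNormedType.Exports.

Local Open Scope ring_scope.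

(** Poisson approximation by size biasing.  Let T_i be the number of monochromatic
hyperedges of layer i.  For a hyperedge e of layer i and a vertex v of e, giving the
color of v to all of e turns the uniform coloring into the uniform coloring
conditioned on e being monochromatic ([average_mono]).  Hence, for k in N^d and
writing k + 1_i for k with its i-th entry incremented,
  (k_i + 1) P(T = k + 1_i) = E(T_i; T = k + 1_i)
                           = sum over e of P(e mono) P(T' = k + 1_i),
where T' counts the monochromatic hyperedges after recoloring e.  If recoloring e
changes the status of no hyperedge other than e, then T' = T + 1_i, and the right-hand
side is E(T_i) P(T = k), as for independent Poisson variables.

The error ([stein_recursion]) has two sources.  The first is made of the pairs of
distinct hyperedges sharing at least two vertices ([overlap]).  Within one layer,
exactly these pairs of distinct hyperedges are correlated, so their contribution tends
to 0 because the mean and the variance have the same limit ([overlap_le_variance]).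
For two different layers, the Cauchy-Schwarz inequality over the common part reduces
the estimate to the single layers ([overlap_sqr_le]); two distinct
hyperedges have a common part strictly smaller than one of them, which makes one factor
small.  Disjointness of the layers ensures that e contributes to T_i only.  The second
source is made of the hyperedges that meet e in a single vertex other than v.  They may
be numerous, as in a star recolored from a leaf, and this is where the choice of v
matters: v is a vertex of maximal degree in e.  Then all the other vertices of e have
degree at most the geometric mean of their degree and that of v, and the small
codegrees of pairs make the error small ([sum_non_anchor_le]).

In the limit, P(T = k) satisfies the recursion of the Poisson weights, hence is
asymptotically P(T = 0) times the product of lambda_i ^ k_i / k_i!
([cvg_proportional]).  Markov's inequality gives tightness, so P(T = 0) converges to
the Poisson weight at 0 ([cvg_zero]); pointwise convergence of the weights and
tightness give convergence of the expectation of every bounded function of T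
([cvg_expectation]). *)

(** * Averages over finite sets *)

Section Average.
Variable R : realType.

Definition average (T : finType) (F : T -> R) : R := (\sum_x F x) / #|T|%:R.

Lemma eq_average (T : finType) (F G : T -> R) :
  F =1 G -> average F = average G.
Proof. by move=> FG; rewrite /average (eq_bigr G). Qed.

Lemma averageD (T : finType) (F G : T -> R) :
  average (fun x => F x + G x) = average F + average G.
Proof. by rewrite /average big_split mulrDl. Qed.

Lemma averageZ (T : finType) (a : R) (F : T -> R) :
  average (fun x => a * F x) = a * average F.
Proof. by rewrite /average -mulr_sumr mulrA. Qed.

Lemma averageN (T : finType) (F : T -> R) :
  average (fun x => - F x) = - average F.
Proof. by rewrite /average sumrN mulNr. Qed.

Lemma averageB (T : finType) (F G : T -> R) :
  average (fun x => F x - G x) = average F - average G.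
Proof. by rewrite averageD averageN. Qed.

Lemma average_cst (T : finType) (a : R) :
  (0 < #|T|)%N -> average (fun _ : T => a) = a.
Proof.
move=> T0; rewrite /average sumr_const -(mulr_natr a) mulfK//.
by rewrite pnatr_eq0 -lt0n.
Qed.

Lemma average_sum (T I : finType) (P : pred I) (F : I -> T -> R) :
  average (fun x => \sum_(i | P i) F i x) = \sum_(i | P i) average (F i).
Proof. by rewrite /average exchange_big/= mulr_suml. Qed.

Lemma ler_average (T : finType) (F G : T -> R) :
  (forall x, F x <= G x) -> average F <= average G.
Proof. by move=> FG; rewrite ler_wpM2r ?invr_ge0// ler_sum. Qed.

Lemma average_ge0 (T : finType) (F : T -> R) :
  (forall x, 0 <= F x) -> 0 <= average F.
Proof. by move=> F0; rewrite divr_ge0// sumr_ge0. Qed.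

Lemma ler_norm_average (T : finType) (F : T -> R) :
  `|average F| <= average (fun x => `|F x|).
Proof.
by rewrite normrM normfV normr_nat ler_wpM2r ?invr_ge0// ler_norm_sum.
Qed.

End Average.

(** * Size biasing by recoloring *)

Section Recoloring.
Variables (R : realType) (V : finType) (c : nat).
Hypothesis c_gt0 : (0 < c)%N.
Local Notation coloring := {ffun V -> 'I_c}.
Implicit Types (x y : coloring) (e S : {set V}) (v : V).

Definition mono x e : bool := monochromatic (fun v => x v : nat) e.

Lemma monoP x e :
  reflect {in e &, forall v w, x v = x w} (mono x e).
Proof.
apply: (iffP forall_inP) => [h v w ve we|h v ve].
  by apply/val_inj/eqP; have /forall_inP := h v ve; apply.
by apply/forall_inP => w we; rewrite (h v w).
Qed.

(** The probability that [e] is monochromatic, see [average_mono1]; the truncated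
predecessor makes this true for the empty set as well. *)
Definition mass e : R := (c%:R ^+ #|e|.-1)^-1.

Definition recolor e v x : coloring :=
  [ffun w => if w \in e then x v else x w].

Lemma natc_gt0 : 0 < c%:R :> R. Proof. by rewrite ltr0n. Qed.
Lemma natc_neq0 : c%:R != 0 :> R. Proof. by rewrite lt0r_neq0// natc_gt0. Qed.

Lemma mass_ge0 e : 0 <= mass e. Proof. by rewrite invr_ge0 exprn_ge0. Qed.

Lemma mono_recolor_self e v x : mono (recolor e v x) e.
Proof. by apply/monoP => w w' we we'; rewrite !ffunE we we'. Qed.

Lemma card_recolor_fiber e v y : v \in e -> mono y e ->
  #|[set x | recolor e v x == y]| = (c ^ #|e|.-1)%N.
Proof.
move=> ve ye.
pose F w := if w \in e :\ v then predT else pred1 (y w).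
have -> : [set x | recolor e v x == y] = [set x in family F].
  apply/setP => x; rewrite !inE; apply/eqP/familyP => [xy w|xF].
    rewrite /F !inE; case: ifPn => //; rewrite negb_and negbK inE.
    rewrite -xy ffunE => /orP[/eqP ->|/negbTE ->]; last exact: eqxx.
    by rewrite ve.
  apply/ffunP => w; rewrite ffunE; case: ifP => we.
    have := xF v; rewrite /F !inE eqxx/= => /eqP ->.
    by move/monoP : ye; apply.
  by have := xF w; rewrite /F !inE we andbF => /eqP.
rewrite cardsE card_family.
rewrite (_ : #|e|.-1 = #|e :\ v|); last by rewrite (cardsD1 v e) ve.
transitivity (\prod_w (if w \in e :\ v then c else 1))%N.
  rewrite foldrE big_map big_enum; apply: eq_bigr => w _.
  by rewrite /F; case: ifP => _; rewrite ?card1// -[RHS]card_ord; apply: eq_card.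
by rewrite -big_mkcond/= prod_nat_const.
Qed.

(** Size biasing.  Among the colorings that [recolor e v] sends to a given
coloring that is monochromatic on [e], only the colors of the other vertices of
[e] are free, so these fibers all have the same cardinality. *)
Lemma average_mono e v (F : coloring -> R) : v \in e ->
  average (fun x => (mono x e)%:R * F x) =
  mass e * average (fun x => F (recolor e v x)).
Proof.
move=> ve.
rewrite /average mulrA; congr (_ / _).
rewrite [X in _ = _ * X](partition_big (recolor e v) (mono^~ e)) /=; last first.
  by move=> x _; exact: mono_recolor_self.
rewrite mulr_sumr [RHS]big_mkcond/=; apply: eq_bigr => y _.
case: ifPn => ye; last by rewrite mul0r.
rewrite mul1r (eq_bigr (fun _ => F y)); last by move=> x /eqP ->.
rewrite sumr_const (_ : #|_| = #|[set x | recolor e v x == y]|); last first.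
  by apply: eq_card => x; rewrite [RHS]inE.
rewrite card_recolor_fiber// -mulr_natl natrX mulrA mulVf ?mul1r//.
by rewrite expf_neq0// natc_neq0.
Qed.

Lemma card_coloring : (0 < #|{: coloring}|)%N.
Proof. by rewrite card_ffun card_ord expn_gt0 c_gt0. Qed.

Lemma average_mono1 e : average (fun x => (mono x e)%:R) = mass e.
Proof.
have [->|[v ve]] := set_0Vmem e.
  rewrite /mass cards0 expr0 invr1 -[RHS](@average_cst _ _ _ card_coloring).
  apply: eq_average => x; rewrite (_ : mono x finset.set0)//.
  by apply/monoP => v w; rewrite inE.
under eq_average => x do rewrite -[(_)%:R]mulr1.
by rewrite (average_mono (fun=> 1) ve) (average_cst _ card_coloring) mulr1.
Qed.

(** After recoloring, the vertices of [e :&: e'] all carry the old color of [v]. *)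
Lemma mono_recolor e e' v x : v \in e ->
  mono (recolor e v x) e' =
  mono x (if e :&: e' == finset.set0 then e' else v |: (e' :\: e)).
Proof.
move=> ve; case: eqP => [ee'|/eqP/set0Pn[u]].
  have e'e w : w \in e' -> (w \in e) = false.
    move=> we'; apply/negP => we.
    by have : w \in e :&: e' by [rewrite inE we]; rewrite ee' inE.
  by apply/monoP/monoP => h w w' we we'; have := h w w' we we';
    rewrite !ffunE !e'e.
rewrite inE => /andP[ue ue'].
apply/monoP/monoP => h w w'.
  pose rep w := if w \in e then u else w.
  have key w1 : w1 \in v |: (e' :\: e) ->
      recolor e v x (rep w1) = x w1 /\ rep w1 \in e'.
    rewrite !inE /rep ffunE => /orP[/eqP ->|/andP[/negbTE w1e w1e']].
      by rewrite ve ue ue'.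
    by rewrite w1e w1e w1e'.
  by move=> /key[<- ?] /key[<- ?]; apply: h.
have key w1 : w1 \in e' -> exists2 w2, w2 \in v |: (e' :\: e) &
    recolor e v x w1 = x w2.
  move=> w1e'; rewrite ffunE; case: ifPn => w1e.
    by exists v => //; rewrite !inE eqxx.
  by exists w1 => //; rewrite !inE w1e w1e' orbT.
by move=> /key[w2 ? ->] /key[w3 ? ->]; apply: h.
Qed.

Lemma average_mono_recolor e e' v : v \in e ->
  average (fun x => (mono (recolor e v x) e')%:R) =
  mass e' * c%:R ^+ #|e :&: e'|.-1.
Proof.
move=> ve; under eq_average do rewrite mono_recolor//.
rewrite average_mono1; case: eqP => [->|/eqP ee'].
  by rewrite cards0 expr0 mulr1.
have t0 : (0 < #|e :&: e'|)%N by rewrite card_gt0.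
have te' : (#|e :&: e'| <= #|e'|)%N by rewrite subset_leq_card// finset.subsetIr.
rewrite /mass cardsU1 !inE ve/= cardsD finset.setIC.
rewrite /= -[in RHS](subnK te') -(prednK t0) addnS /=.
by rewrite add0n exprD invfM -mulrA mulVf ?mulr1// expf_neq0// natc_neq0.
Qed.

(** When [e] and [e'] meet, they are both monochromatic exactly when their union is;
when they are disjoint, they are independent.  The truncated predecessor covers
both cases, and shows that sharing a single vertex creates no correlation. *)
Lemma average_mono2 e e' :
  average (fun x => (mono x e)%:R * (mono x e')%:R) =
  mass e * mass e' * c%:R ^+ #|e :&: e'|.-1.
Proof.
have [->|[v ve]] := set_0Vmem e.
  rewrite {1}/mass cards0 finset.set0I cards0 expr0 invr1 mul1r mulr1.
  rewrite -average_mono1; apply: eq_average => x.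
  rewrite (_ : mono x finset.set0) ?mul1r//.
  by apply/monoP => v w; rewrite inE.
by rewrite (average_mono _ ve) average_mono_recolor// mulrA.
Qed.

End Recoloring.

(** * Overlapping hyperedges *)

Lemma cauchy_schwarz_sum (R : realType) (I : finType) (P : pred I)
    (w f g : I -> R) : (forall i, P i -> 0 <= w i) ->
  (\sum_(i | P i) w i * (f i * g i)) ^+ 2 <=
  (\sum_(i | P i) w i * (f i * f i)) * (\sum_(i | P i) w i * (g i * g i)).
Proof.
move=> w0; rewrite -subr_ge0 -(pmulr_rge0 _ (ltr0n R 2)).
rewrite expr2 !big_distrlr/=.
suff -> : 2 * ((\sum_(i | P i) \sum_(j | P j)
      w i * (f i * f i) * (w j * (g j * g j))) -
    \sum_(i | P i) \sum_(j | P j) w i * (f i * g i) * (w j * (f j * g j))) =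
  \sum_(i | P i) \sum_(j | P j) w i * w j * (f i * g j - f j * g i) ^+ 2.
  apply: sumr_ge0 => i Pi; apply: sumr_ge0 => j Pj.
  by rewrite mulr_ge0 ?sqr_ge0// mulr_ge0// w0.
rewrite mulrBr mulr2n mulrDl !mul1r {2}exchange_big/= -big_split/= mulr_sumr.
rewrite -sumrB; apply: eq_bigr => i _; rewrite -big_split/= mulr_sumr -sumrB.
by apply: eq_bigr => j _; ring.
Qed.

Section Overlaps.
Variables (R : realType) (V : finType) (c : nat).
Hypothesis c_gt1 : (1 < c)%N.
Local Notation coloring := {ffun V -> 'I_c}.
Local Notation mu := (mass R c).
Implicit Types (H : {set {set V}}) (x : coloring) (e S : {set V}) (v : V).

Let c_gt0 : (0 < c)%N. Proof. exact: ltnW. Qed.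
Let c1 : 1 <= c%:R :> R. Proof. by rewrite ler1n. Qed.
Let c0 : 0 < c%:R :> R. Proof. by rewrite ltr0n. Qed.
Let c_neq0 : c%:R != 0 :> R. Proof. exact: lt0r_neq0. Qed.
Let mu_ge0 e : 0 <= mu e. Proof. exact: mass_ge0. Qed.
Hint Resolve mu_ge0 : core.

Definition num_mono H x : nat := num_monochromatic H (fun v => x v : nat).

Definition mean H : R := \sum_(e in H) mu e.

Lemma mean_ge0 H : 0 <= mean H.
Proof. by apply: sumr_ge0. Qed.

Lemma num_monoE H x : (num_mono H x)%:R = \sum_(e in H) (mono x e)%:R :> R.
Proof. by rewrite /num_mono /num_monochromatic natr_sum. Qed.

Lemma average_num_mono H : average (fun x => (num_mono H x)%:R) = mean H.
Proof.
under eq_average do rewrite num_monoE.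
by rewrite average_sum; apply: eq_bigr => e _; rewrite average_mono1.
Qed.

Lemma average_num_mono_var H :
  average (fun x => ((num_mono H x)%:R - mean H) ^+ 2) =
  \sum_(e in H) \sum_(e' in H)
    mu e * mu e' * (c%:R ^+ #|e :&: e'|.-1 - 1).
Proof.
transitivity (average (fun x : coloring => (num_mono H x)%:R ^+ 2 : R) - mean H ^+ 2).
  transitivity (average (fun x : coloring => (num_mono H x)%:R ^+ 2
      - (2 * mean H) * (num_mono H x)%:R + mean H ^+ 2)).
    by apply: eq_average => x; ring.
  rewrite averageD averageB averageZ average_num_mono average_cst; last first.
    exact: card_coloring.
  by ring.
transitivity (\sum_(e in H) \sum_(e' in H)
    mu e * mu e' * c%:R ^+ #|e :&: e'|.-1
  - \sum_(e in H) \sum_(e' in H) mu e * mu e').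
  congr (_ - _); last by rewrite expr2 big_distrlr.
  under eq_average do rewrite num_monoE expr2 big_distrlr/=.
  rewrite average_sum; apply: eq_bigr => e _.
  rewrite average_sum; apply: eq_bigr => e' _.
  exact: average_mono2.
rewrite -sumrB; apply: eq_bigr => e _; rewrite -sumrB.
by apply: eq_bigr => e' _; rewrite mulrBr mulr1.
Qed.

(** The probability that both hyperedges are monochromatic, summed over the
pairs of distinct hyperedges sharing at least two vertices. *)
Definition overlap H H' : R :=
  \sum_(e in H) \sum_(e' in H' | (e' != e) && (1 < #|e :&: e'|)%N)
    mu e * mu e' * c%:R ^+ #|e :&: e'|.-1.

Lemma overlap_ge0 H H' : 0 <= overlap H H'.
Proof.
by apply: sumr_ge0 => e _; apply: sumr_ge0 => e' _; rewrite !mulr_ge0// exprn_ge0.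
Qed.

Lemma overlapC H H' : overlap H H' = overlap H' H.
Proof.
rewrite /overlap !pair_big_dep/=.
rewrite (reindex_inj (h := fun p : {set V} * {set V} => (p.2, p.1))) /=; last first.
  by move=> [? ?] [? ?] [-> ->].
apply: eq_big => [[e e']|[e e'] _] /=.
  by rewrite andbCA eq_sym finset.setIC.
by rewrite finset.setIC (mulrC (mu e)).
Qed.

Lemma mass_le e : (1 < #|e|)%N -> mu e <= c%:R^-1.
Proof.
move=> e1; rewrite /mass lef_pV2 ?posrE ?exprn_gt0//.
by rewrite -[leLHS]expr1 ler_weXn2l// -ltnS prednK// ltnW.
Qed.

Lemma mass_diag e : mu e * mu e * c%:R ^+ #|e :&: e|.-1 = mu e.
Proof.
by rewrite finset.setIid -mulrA /mass mulVf ?mulr1// expf_neq0.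
Qed.

Lemma sum_mass_sqr H : {in H, forall e, (1 < #|e|)%N} ->
  \sum_(e in H) mu e * mu e <= c%:R^-1 * mean H.
Proof.
move=> H2; rewrite mulr_sumr; apply: ler_sum => e eH.
by rewrite ler_wpM2r// mass_le// H2.
Qed.

(** Two hyperedges with at most one common vertex are uncorrelated, and the
covariance of two distinct hyperedges with more common vertices is at least half
of their joint probability.  The diagonal of the variance is almost the mean, so
equality of the limits of mean and variance kills the overlaps. *)
Lemma overlap_le_variance H : {in H, forall e, (1 < #|e|)%N} ->
  overlap H H <= 2 *
    (average (fun x => ((num_mono H x)%:R - mean H) ^+ 2) - mean H
     + c%:R^-1 * mean H).
Proof.
move=> H2; rewrite average_num_mono_var.
have sqrH := sum_mass_sqr H2.
suff : overlap H H <= 2 * (\sum_(e in H) \sum_(e' in H)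
    mu e * mu e' * (c%:R ^+ #|e :&: e'|.-1 - 1) - mean H
     + \sum_(e in H) mu e * mu e) by lra.
rewrite -sumrB -big_split mulr_sumr /=; apply: ler_sum => e eH.
rewrite [X in 2 * (X - _ + _)](bigD1 e)//= mulrBr mulr1 mass_diag.
rewrite [X in 2 * X](_ : _ = \sum_(i in H | i != e)
  mu e * mu i * (c%:R ^+ #|e :&: i|.-1 - 1)); last by ring.
rewrite mulr_sumr big_mkcondr [leRHS]big_mkcondr/= big_mkcond [leRHS]big_mkcond/=.
apply: ler_sum => e' _; case: ifP => // _.
case: eqP => //= _; have me := mu_ge0 e; have me' := mu_ge0 e'.
have mm : 0 <= mu e * mu e' by exact: mulr_ge0.
case: ifPn => [|_]; last first.
  by rewrite !mulr_ge0// subr_ge0 exprn_ege1.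
case: #|_| => [//|[//|k]] _ /=; rewrite mulrCA ler_wpM2l// mulrBr.
have : 2 <= c%:R ^+ k.+1 :> R; last by lra.
by rewrite -natrX ler_nat (leq_trans c_gt1)// -{1}(expn1 c) leq_pexp2l.
Qed.

(** The hyperedges are weighted by the probability that they are monochromatic. *)
Definition codegree H (A : {set V} -> bool) : R := \sum_(e in H | A e) mu e.

Lemma sum_codegree (T : finType) (Q : pred T) (w : T -> R)
    (A B : T -> {set V} -> bool) H H' :
  \sum_(S | Q S) w S * (codegree H (A S) * codegree H' (B S)) =
  \sum_(e in H) \sum_(e' in H')
    mu e * mu e' * \sum_(S | [&& Q S, A S e & B S e']) w S.
Proof.
transitivity (\sum_(S | Q S) \sum_(e in H) \sum_(e' in H')
    if A S e && B S e' then mu e * mu e' * w S else 0).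
  apply: eq_bigr => S _; rewrite /codegree big_distrlr/= mulr_sumr.
  rewrite big_mkcondr/=; apply: eq_bigr => e _; case: ifP => _; last first.
    by rewrite /= big1.
  rewrite mulr_sumr big_mkcondr/=; apply: eq_bigr => e' _.
  by case: ifP => // _; rewrite mulrC.
rewrite exchange_big; apply: eq_bigr => e _.
rewrite exchange_big; apply: eq_bigr => e' _.
by rewrite mulr_sumr -big_mkcondr.
Qed.

(** The diagonal pairs contribute the mean, by [mass_diag]. *)
Lemma sum_overlapping_pairs H : {in H, forall e, (1 < #|e|)%N} ->
  \sum_(e in H) \sum_(e' in H | (1 < #|e :&: e'|)%N)
    mu e * mu e' * c%:R ^+ #|e :&: e'|.-1 = mean H + overlap H H.
Proof.
move=> H2; rewrite -big_split; apply: eq_bigr => e eH /=.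
rewrite (bigD1 e) /=; last by rewrite eH finset.setIid H2.
rewrite mass_diag; congr (_ + _).
by apply: eq_bigl => e'; rewrite -andbA (andbC (_ < _)%N).
Qed.

Lemma card_subsets_le S r : (#|S| <= r)%N ->
  #|[set S' : {set V} | S' \subset S]|%:R <= 2 ^+ r :> R.
Proof.
move=> Sr; rewrite -natrX ler_nat.
by rewrite (_ : finset _ = powerset S)// card_powerset leq_pexp2l.
Qed.

Lemma sum_subsets_le (Q : pred {set V}) S r k : (#|S| <= r)%N ->
  (forall S', Q S' -> (S' \subset S) && (#|S'|.-1 <= k)%N) ->
  \sum_(S' | Q S') c%:R ^+ #|S'|.-1 <= 2 ^+ r * c%:R ^+ k :> R.
Proof.
move=> Sr QS; apply: (@le_trans _ _ (\sum_(S' | Q S') c%:R ^+ k)).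
  by apply: ler_sum => S' /QS/andP[_ ?]; rewrite ler_weXn2l.
rewrite sumr_const -(mulr_natl (c%:R ^+ k)) ler_wpM2r ?exprn_ge0//.
apply: le_trans (card_subsets_le Sr); rewrite ler_nat subset_leq_card//.
by apply/fintype.subsetP => S' /QS/andP[]; rewrite inE.
Qed.

(** Only pairs [e], [e'] with [S] contained in [e :&: e'] contribute, and there are at
most [2 ^+ r] such [S]. *)
Lemma sum_codegree_sqr H r : {in H, forall e, (1 < #|e| <= r)%N} ->
  \sum_(S : {set V} | (1 < #|S|)%N) c%:R ^+ #|S|.-1 *
    (codegree H (fun e => S \subset e) * codegree H (fun e => S \subset e))
  <= 2 ^+ r * (mean H + overlap H H).
Proof.
move=> Hr; rewrite sum_codegree -sum_overlapping_pairs; last first.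
  by move=> e /Hr/andP[].
rewrite mulr_sumr; apply: ler_sum => e eH.
rewrite mulr_sumr [leRHS]big_mkcondr/=; apply: ler_sum => e' _.
case: ifPn => [_|]; last first.
  rewrite -leqNgt => ee'; rewrite big1 ?mulr0// => S /and3P[S1 Se Se'].
  have : (#|S| <= #|e :&: e'|)%N by rewrite subset_leq_card// finset.subsetI Se.
  by rewrite leqNgt (leq_ltn_trans ee').
rewrite mulrCA ler_wpM2l ?mulr_ge0//; apply: (@sum_subsets_le _ (e :&: e')).
  have /andP[_ er] := Hr _ eH.
  by rewrite (leq_trans _ er)// subset_leq_card// finset.subsetIl.
move=> S /and3P[_ Se Se']; have See' : S \subset e :&: e' by rewrite finset.subsetI Se.
by rewrite See'/= -!subn1 leq_sub2r// subset_leq_card.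
Qed.

(** Excluding [S = e] from the sum replaces the diagonal term of [mass_diag] by a
term smaller by a factor [c]. *)
Lemma sum_proper_codegree_sqr H r : {in H, forall e, (1 < #|e| <= r)%N} ->
  \sum_(S : {set V} | (1 < #|S|)%N) c%:R ^+ #|S|.-1 *
    (codegree H (fun e => S \proper e) * codegree H (fun e => S \proper e))
  <= 2 ^+ r * (c%:R^-1 * mean H + overlap H H).
Proof.
move=> Hr; rewrite sum_codegree mulr_sumr -big_split mulr_sumr/=.
apply: ler_sum => e eH; rewrite (bigD1 e)//= mulrDr.
have /andP[e1 er] := Hr _ eH.
apply: lerD.
  have diag : c%:R^-1 * mu e = mu e * mu e * c%:R ^+ #|e|.-2.
    rewrite -[in LHS](mass_diag e) finset.setIid -(prednK (n := #|e|.-1)).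
      by rewrite exprS/= [LHS]mulrCA mulKf.
    by rewrite -ltnS prednK// ltnW.
  rewrite diag [leRHS]mulrCA ler_wpM2l ?mulr_ge0//.
  apply: (@sum_subsets_le _ e) => // S /and3P[S1 Se _].
  by rewrite (proper_sub Se)/=; have := proper_card Se; lia.
rewrite mulr_sumr big_mkcondr [leRHS]big_mkcondr/=.
rewrite big_mkcond [leRHS]big_mkcond/=.
apply: ler_sum => e' _; case: ifP => // _.
case: eqP => //= _; case: ifPn => [_|]; last first.
  rewrite -leqNgt => ee'; rewrite big1 ?mulr0// => S /and3P[S1 Se Se'].
  have : (#|S| <= #|e :&: e'|)%N.
    by rewrite subset_leq_card// finset.subsetI !proper_sub.
  by rewrite leqNgt (leq_ltn_trans ee').
rewrite mulrCA ler_wpM2l ?mulr_ge0//; apply: (@sum_subsets_le _ (e :&: e')).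
  by rewrite (leq_trans _ er)// subset_leq_card// finset.subsetIl.
move=> S /and3P[_ Se Se'].
have See' : S \subset e :&: e' by rewrite finset.subsetI !proper_sub.
by rewrite See'/= -!subn1 leq_sub2r// subset_leq_card.
Qed.

(** Each pair of hyperedges is counted at [S = e :&: e']. *)
Lemma overlap_le_codegree H H' :
  {in H & H', forall e e', (#|e| <= #|e'|)%N} ->
  overlap H H' <= \sum_(S : {set V} | (1 < #|S|)%N) c%:R ^+ #|S|.-1 *
    (codegree H (fun e => S \subset e) * codegree H' (fun e => S \proper e)).
Proof.
move=> HH'; rewrite sum_codegree; apply: ler_sum => e eH.
rewrite big_mkcondr/=; apply: ler_sum => e' eH'.
case: ifPn => [/andP[e'e ee'1]|_]; last first.
  by rewrite !mulr_ge0// sumr_ge0// => S _; rewrite exprn_ge0.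
rewrite ler_wpM2l ?mulr_ge0// (bigD1 (e :&: e'))/=; last first.
  rewrite ee'1 finset.subsetIl finset.properEneq finset.subsetIr andbT /=.
  apply: contra e'e => /eqP/finset.setIidPr e'e.
  by rewrite eqEcard e'e HH'.
by rewrite lerDl sumr_ge0// => S _; rewrite exprn_ge0.
Qed.

End Overlaps.

Section Codegrees.
Variables (R : realType) (V : finType) (c : nat).
Hypothesis c_gt1 : (1 < c)%N.
Local Notation coloring := {ffun V -> 'I_c}.
Local Notation mu := (mass R c).
Local Notation mean := (mean R c).
Local Notation overlap := (overlap R c).
Local Notation codegree := (codegree R c).
Implicit Types (H : {set {set V}}) (x : coloring) (e S : {set V}) (v : V).

Let c_gt0 : (0 < c)%N. Proof. exact: ltnW. Qed.
Let c1 : 1 <= c%:R :> R. Proof. by rewrite ler1n. Qed.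
Let c0 : 0 < c%:R :> R. Proof. by rewrite ltr0n. Qed.
Let c_neq0 : c%:R != 0 :> R. Proof. exact: lt0r_neq0. Qed.
Let mu_ge0 e : 0 <= mu e. Proof. exact: mass_ge0. Qed.
Hint Resolve mu_ge0 : core.

(** The common part [S] of two distinct hyperedges [e] in [H] and [e'] in [H'] is
properly contained in [e'], which is at least as large as [e].  The Cauchy-Schwarz inequality
over [S] bounds the overlap of two layers by the means and the overlaps of each
layer with itself; the factor of [H'] is small. *)
Lemma overlap_sqr_le H H' r :
  {in H, forall e, (1 < #|e| <= r)%N} -> {in H', forall e, (1 < #|e| <= r)%N} ->
  {in H & H', forall e e', (#|e| <= #|e'|)%N} ->
  overlap H H' ^+ 2 <= (2 ^+ r * (mean H + overlap H H)) *
                       (2 ^+ r * (c%:R^-1 * mean H' + overlap H' H')).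
Proof.
move=> Hr H'r HH'.
apply: le_trans (ler_pM _ _ (sum_codegree_sqr R c_gt1 Hr)
                            (sum_proper_codegree_sqr R c_gt1 H'r)).
- apply: le_trans (cauchy_schwarz_sum _ _ _); last by move=> S _; exact: exprn_ge0.
  rewrite lerXn2r ?nnegrE ?overlap_ge0 ?(le_trans (overlap_ge0 R c H H'))//;
    exact: overlap_le_codegree.
- by apply: sumr_ge0 => S _; rewrite mulr_ge0 ?exprn_ge0// -expr2 sqr_ge0.
- by apply: sumr_ge0 => S _; rewrite mulr_ge0 ?exprn_ge0// -expr2 sqr_ge0.
Qed.

(** Two hyperedges sharing a pair of vertices are both monochromatic with a
probability at least [c] times the product of their masses, whence the factor
[c^-1]. *)
Lemma sum_pair_codegree_sqr H r : {in H, forall e, (1 < #|e| <= r)%N} ->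
  \sum_(p : V * V | p.1 != p.2) 1 *
    (codegree H (fun e => (p.1 \in e) && (p.2 \in e)) *
     codegree H (fun e => (p.1 \in e) && (p.2 \in e)))
  <= r%:R ^+ 2 * (c%:R^-1 * (mean H + overlap H H)).
Proof.
move=> Hr.
rewrite (sum_codegree c (fun p : V * V => p.1 != p.2) (fun=> 1)
  (fun p e => (p.1 \in e) && (p.2 \in e)) (fun p e => (p.1 \in e) && (p.2 \in e))).
rewrite -sum_overlapping_pairs//; last by move=> e /Hr/andP[].
rewrite mulrA mulr_sumr; apply: ler_sum => e eH.
rewrite mulr_sumr [leRHS]big_mkcondr/=; apply: ler_sum => e' _.
rewrite sumr_const; case: ifPn => [ee'|]; last first.
  rewrite -leqNgt => ee'; rewrite eq_card0 ?mulr0// => -[u v].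
  rewrite !inE/=; apply/negP => /and3P[uv /andP[ue ve] /andP[ue' ve']].
  suff : (#|[set u; v]| <= #|e :&: e'|)%N by rewrite cards2 uv leqNgt ltnS ee'.
  apply/subset_leq_card/fintype.subsetP => w.
  by rewrite !inE => /orP[]/eqP ->; rewrite ?ue ?ve.
have c1e : 1 <= c%:R^-1 * c%:R ^+ #|e :&: e'|.-1 :> R.
  rewrite mulrC ler_pdivlMr// mul1r -[leLHS]expr1 ler_weXn2l//.
  by rewrite -ltnS prednK// ltnW.
rewrite [leRHS]mulrCA ler_wpM2l ?mulr_ge0// -mulrA.
apply: (@le_trans _ _ (r%:R ^+ 2)); last by rewrite ler_peMr ?exprn_ge0.
have /andP[_ er] := Hr _ eH.
rewrite -natrX ler_nat (leq_trans _ (leq_mul er er))// -cardsX subset_leq_card//.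
by apply/fintype.subsetP => -[u v]; rewrite !inE/= => /and3P[_ /andP[-> ->]].
Qed.

(** For a vertex [u] of [e] other than [a e], the weight [W u] is the minimum of
[W u] and [W (a e)], and the square of this minimum is at most their product.  By
the Cauchy-Schwarz inequality over the pairs of vertices, the sum is therefore at
most the l2 norm of the pair codegrees times the total weight. *)
Lemma sum_non_anchor_le H r (W : V -> R) (a : {set V} -> V) :
  {in H, forall e, (1 < #|e| <= r)%N} -> (forall v, 0 <= W v) ->
  {in H, forall e, a e \in e} -> {in H, forall e, {in e, forall v, W v <= W (a e)}} ->
  (\sum_(e in H) mu e * \sum_(v in e :\ a e) W v) ^+ 2 <=
  r%:R ^+ 2 * (c%:R^-1 * (mean H + overlap H H)) * (\sum_v W v) ^+ 2.
Proof.
move=> Hr W0 ae aW.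
pose m (p : V * V) := Num.min (W p.1) (W p.2).
have m0 p : 0 <= m p by rewrite le_min !W0.
pose D (p : V * V) := codegree H (fun e => (p.1 \in e) && (p.2 \in e)).
have LHS0 : 0 <= \sum_(e in H) mu e * \sum_(v in e :\ a e) W v.
  by apply: sumr_ge0 => e _; rewrite mulr_ge0// sumr_ge0.
have step : \sum_(e in H) mu e * \sum_(v in e :\ a e) W v <=
    \sum_(p : V * V | p.1 != p.2) 1 * (D p * m p).
  have -> : \sum_(p : V * V | p.1 != p.2) 1 * (D p * m p) =
      \sum_(e in H) mu e *
        \sum_(p : V * V | (p.1 != p.2) && ((p.1 \in e) && (p.2 \in e))) m p.
    transitivity (\sum_(p : V * V | p.1 != p.2) \sum_(e in H)
      if (p.1 \in e) && (p.2 \in e) then mu e * m p else 0).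
      apply: eq_bigr => p _; rewrite mul1r /D /codegree big_mkcondr/= mulr_suml.
      by apply: eq_bigr => e _; case: ifP; rewrite ?mul0r.
    rewrite exchange_big; apply: eq_bigr => e _ /=.
    by rewrite mulr_sumr -big_mkcondr.
  apply: ler_sum => e eH; rewrite ler_wpM2l//.
  rewrite (eq_bigl (fun p : V * V => (p.1 \in e) && ((p.2 \in e) && (p.1 != p.2)))); last first.
    by move=> p; rewrite andbC -andbA.
  rewrite -(pair_big_dep (mem e) (fun u v => (v \in e) && (u != v))
    (fun u v => m (u, v)))/=.
  rewrite [leRHS](bigD1 (a e)) ?ae//= -[leLHS]addr0 lerD//; last first.
    by apply: sumr_ge0 => u _; exact: sumr_ge0.
  rewrite le_eqVlt; apply/orP; left; apply/eqP; apply: eq_big => [v|v].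
    by rewrite !inE eq_sym andbC.
  rewrite !inE => /andP[_ ve]; rewrite /m/= min_r//.
  exact: aW.
apply: (@le_trans _ _ ((\sum_(p : V * V | p.1 != p.2) 1 * (D p * m p)) ^+ 2)).
  by rewrite lerXn2r ?nnegrE// (le_trans LHS0).
apply: le_trans (cauchy_schwarz_sum _ _ _) _ => //.
apply: ler_pM.
- by apply: sumr_ge0 => p _; rewrite mul1r -expr2 sqr_ge0.
- by apply: sumr_ge0 => p _; rewrite mul1r -expr2 sqr_ge0.
- exact: sum_pair_codegree_sqr.
rewrite expr2 big_distrlr/= pair_big/= [leRHS](bigID (fun p => p.1 != p.2))/=.
rewrite -[leLHS]addr0 lerD//; last by apply: sumr_ge0 => p _; rewrite mulr_ge0.
apply: ler_sum => p _; rewrite mul1r; apply: ler_pM => //.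
  by rewrite ge_min lexx.
by rewrite ge_min lexx orbT.
Qed.

End Codegrees.

(** * The approximate Poisson recursion *)

Section SteinRecursion.
Variables (R : realType) (V : finType) (c : nat).
Hypothesis c_gt1 : (1 < c)%N.
Local Notation coloring := {ffun V -> 'I_c}.
Local Notation mu := (mass R c).
Local Notation mean := (mean R c).
Local Notation overlap := (overlap R c).
Local Notation codegree := (codegree R c).
Variables (d : nat) (H : 'I_d -> {set {set V}}) (r : nat).
Implicit Types (e : {set V}).
Hypothesis Hr : forall i, {in H i, forall e, (1 < #|e| <= r)%N}.
Hypothesis H_disjoint : forall i j e, e \in H i -> e \in H j -> i = j.
Implicit Types (x : coloring) (v : V) (i j : 'I_d).
Implicit Type k : {ffun 'I_d -> nat}.

Let c_gt0 : (0 < c)%N. Proof. exact: ltnW. Qed.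
Let c1 : 1 <= c%:R :> R. Proof. by rewrite ler1n. Qed.
Let mu_ge0 e : 0 <= mu e. Proof. exact: mass_ge0. Qed.
Hint Resolve mu_ge0 : core.

Definition layer_counts x : {ffun 'I_d -> nat} := [ffun i => num_mono (H i) x].

Definition increment k i : {ffun 'I_d -> nat} := [ffun j => (k j + (j == i))%N].

Lemma increment_inj i : injective (increment^~ i).
Proof.
move=> k k' /ffunP kk'; apply/ffunP => j.
by have := kk' j; rewrite !ffunE => /addIn.
Qed.

Lemma layer_counts_recolor i e v x : e \in H i -> v \in e -> ~~ mono x e ->
  (forall j e', e' \in H j -> e' != e -> e' :&: (e :\ v) != finset.set0 ->
     mono (recolor e v x) e' = mono x e') ->
  layer_counts (recolor e v x) = increment (layer_counts x) i.
Proof.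
move=> eH ve xe same; apply/ffunP => j; rewrite !ffunE.
have split_e y : num_mono (H j) y = ((e \in H j) && mono y e +
    \sum_(e' | e' != e) if e' \in H j then mono y e' : nat else 0)%N.
  rewrite /num_mono /num_monochromatic big_mkcond (bigD1 e)//=; congr (_ + _)%N.
  by case: (e \in H j).
rewrite !split_e mono_recolor_self (negbTE xe) andbT andbF add0n [LHS]addnC.
congr (_ + _)%N; last first.
  by congr nat_of_bool; apply/idP/eqP => [/(H_disjoint eH) ->|->].
apply: eq_bigr => e' e'e; case: ifP => // e'H; congr nat_of_bool.
have [|ee'] := eqVneq (e' :&: (e :\ v)) finset.set0; last first.
  exact: (same _ _ e'H e'e ee').
move=> /setP ee'.
have fixed w : w \in e' -> recolor e v x w = x w.
  move=> we'; rewrite ffunE; case: ifP => // we.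
  by have := ee' w; rewrite !inE we we' !andbT => /negbFE/eqP ->.
by apply/monoP/monoP => h w w' we we'; have := h w w' we we'; rewrite !fixed.
Qed.

(** The hyperedges whose colors can change when [e] takes the color of [v]. *)
Definition touching e v j : pred {set V} :=
  [pred e' | [&& e' \in H j, e' != e & e' :&: (e :\ v) != finset.set0]].

(** The counts are incremented at [i], unless [e] was monochromatic already or some
touching hyperedge is monochromatic before or after the recoloring. *)
Lemma recolor_error i e v k x : e \in H i -> v \in e ->
  `|(layer_counts (recolor e v x) == increment k i)%:R - (layer_counts x == k)%:R| <=
  (mono x e)%:R + \sum_j \sum_(e' | touching e v j e')
    ((mono x e')%:R + (mono (recolor e v x) e')%:R) :> R.
Proof.
move=> eH ve.
have S0 j e' : 0 <= (mono x e')%:R + (mono (recolor e v x) e')%:R :> R.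
  by rewrite addr_ge0.
have SS0 j : 0 <= \sum_(e' | touching e v j e')
    ((mono x e')%:R + (mono (recolor e v x) e')%:R) :> R by exact: sumr_ge0.
have le1 (a b : bool) : `|a%:R - b%:R| <= 1 :> R.
  by case: a; case: b; rewrite ?subrr ?subr0 ?sub0r ?normrN ?normr1 ?normr0.
have [xe|xe] := boolP (mono x e).
  by rewrite (le_trans (le1 _ _))// lerDl sumr_ge0.
rewrite add0r.
case: (pselect (forall j e', e' \in H j -> e' != e ->
   e' :&: (e :\ v) != finset.set0 -> mono (recolor e v x) e' = mono x e')) => [same|].
  rewrite (layer_counts_recolor eH ve xe same) (inj_eq (@increment_inj i)) subrr.
  by rewrite normr0 sumr_ge0.
move=> /existsNP[j /existsNP[e' /not_implyP[e'H /not_implyP[e'e /not_implyP[ee' diff]]]]].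
apply: le_trans (le1 _ _) _.
rewrite (bigD1 j)//= (bigD1 e')/=; last by rewrite /touching !inE e'H e'e ee'.
apply: (@le_trans _ _ ((mono x e')%:R + (mono (recolor e v x) e')%:R)).
  by move: diff; case: (mono x e'); case: (mono _ e') => // _; rewrite ?addr0 ?add0r.
by rewrite -addrA lerDl addr_ge0// sumr_ge0.
Qed.

Definition degree v : R := \sum_j codegree (H j) (fun e => v \in e).

Lemma degree_ge0 v : 0 <= degree v.
Proof. by do 2 (apply: sumr_ge0 => ? _). Qed.

Lemma sum_degree_le : \sum_v degree v <= r%:R * \sum_j mean (H j).
Proof.
rewrite exchange_big mulr_sumr; apply: ler_sum => j _ /=.
rewrite /codegree mulr_sumr.
rewrite (eq_bigr (fun v => \sum_(e in H j) if v \in e then mu e else 0)); last first.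
  by move=> v _; rewrite big_mkcondr.
rewrite exchange_big; apply: ler_sum => e eH /=.
rewrite -big_mkcond/= sumr_const -(mulr_natl (mu e)) ler_wpM2r// ler_nat.
by case/andP: (Hr eH).
Qed.

(** A touching hyperedge that shares at least two vertices with [e] is charged to the
overlaps.  The others meet [e] in a single vertex other than [v], and are charged to
the degree of this vertex: a vertex of large degree in [e] is harmless when it is
chosen as [v]. *)
Lemma average_recolor_error i e v k : e \in H i -> v \in e ->
  `|average (fun x => (layer_counts (recolor e v x) == increment k i)%:R)
    - average (fun x => (layer_counts x == k)%:R)| <=
  mu e + 2 * (\sum_j \sum_(e' in H j | (e' != e) && (1 < #|e :&: e'|)%N)
                mu e' * c%:R ^+ #|e :&: e'|.-1
              + \sum_(u in e :\ v) degree u).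
Proof.
move=> eH ve; rewrite -averageB.
apply: le_trans (ler_norm_average _) _.
apply: le_trans (ler_average (fun x => recolor_error k x eH ve)) _.
rewrite averageD average_mono1// lerD2l average_sum.
rewrite exchange_big -big_split/= mulr_sumr; apply: ler_sum => j _.
rewrite average_sum.
rewrite (eq_bigr (fun e' => mu e' + mu e' * c%:R ^+ #|e :&: e'|.-1)); last first.
  by move=> e' _; rewrite averageD average_mono1// average_mono_recolor.
have -> : \sum_(u in e :\ v) codegree (H j) (fun e' => u \in e') =
    \sum_(e' in H j) \sum_(u in e :\ v) if u \in e' then mu e' else 0.
  rewrite exchange_big; apply: eq_bigr => u _.
  by rewrite /codegree big_mkcondr.
rewrite [X in _ <= _ * (X + _)]big_mkcondr -big_split/= mulr_sumr.
rewrite (eq_bigl (fun e' => (e' \in H j) &&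
  ((e' != e) && (e' :&: (e :\ v) != finset.set0)))); last by [].
rewrite big_mkcondr/=; apply: ler_sum => e' e'H.
have sum0 : 0 <= \sum_(u in e :\ v) (if u \in e' then mu e' else 0).
  by apply: sumr_ge0 => u _; case: ifP.
case: (eqVneq e' e) => /= [_|e'e]; first by rewrite mulr_ge0 ?addr_ge0.
case: ifPn => [/set0Pn[u]|_]; last first.
  by rewrite mulr_ge0 ?addr_ge0//; case: ifP => // _; rewrite mulr_ge0// exprn_ge0.
rewrite finset.in_setI => /andP[ue' uev].
case: ifPn => [_|].
  have : mu e' <= mu e' * c%:R ^+ #|e :&: e'|.-1 by rewrite ler_peMr// exprn_ege1.
  by lra.
rewrite -leqNgt add0r -ltnS => ee'.
rewrite (_ : #|_|.-1 = 0%N) ?expr0 ?mulr1; last by move: ee'; case: #|_| => [|[]].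
set s := \sum_(u in e :\ v) _; suff : mu e' <= s by lra.
rewrite /s (bigD1 u)//= ue' lerDl; apply: sumr_ge0 => w _; by case: ifP.
Qed.

(** The first average, multiplied by [(k i).+1], is a sum over the hyperedges [e] of
layer [i] of the probability that [e] is monochromatic and the counts are
[increment k i]; by size biasing, [e] can be taken monochromatic at the cost of
recoloring it, which nearly amounts to incrementing the counts.  For independent
Poisson variables the difference vanishes. *)
Lemma stein_recursion i k (a : {set V} -> V) :
  {in H i, forall e, a e \in e} ->
  `|(k i).+1%:R * average (fun x => (layer_counts x == increment k i)%:R)
    - mean (H i) * average (fun x => (layer_counts x == k)%:R)| <=
  c%:R^-1 * mean (H i) + 2 * (\sum_j overlap (H i) (H j)
    + \sum_(e in H i) mu e * \sum_(u in e :\ a e) degree u).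
Proof.
move=> ae.
have -> : (k i).+1%:R * average (fun x => (layer_counts x == increment k i)%:R) =
    \sum_(e in H i) mu e *
      average (fun x => (layer_counts (recolor e (a e) x) == increment k i)%:R : R).
  rewrite -averageZ.
  transitivity (average (fun x : coloring => \sum_(e in H i)
      (mono x e)%:R * (layer_counts x == increment k i)%:R : R)).
    apply: eq_average => x; rewrite -mulr_suml -num_monoE.
    case: eqP => [xk|_]; rewrite ?mulr0// !mulr1.
    have := congr1 (fun f : {ffun 'I_d -> nat} => f i) xk.
    by rewrite !ffunE eqxx addn1 => ->.
  rewrite average_sum; apply: eq_bigr => e eH.
  by rewrite (average_mono _ (fun x => (layer_counts x == increment k i)%:R) (ae _ eH)).
rewrite /mean mulr_suml -sumrB.
apply: le_trans (ler_norm_sum _ _ _) _.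
apply: (@le_trans _ _ (\sum_(e in H i) mu e * (mu e + 2 *
  (\sum_j \sum_(e' in H j | (e' != e) && (1 < #|e :&: e'|)%N)
     mu e' * c%:R ^+ #|e :&: e'|.-1 + \sum_(u in e :\ a e) degree u)))).
  apply: ler_sum => e eH; rewrite -mulrBr normrM ger0_norm// ler_wpM2l//.
  by apply: average_recolor_error => //; exact: ae.
rewrite (eq_bigr (fun e => mu e * mu e + 2 * (mu e * \sum_j \sum_(e' in H j |
    (e' != e) && (1 < #|e :&: e'|)%N) mu e' * c%:R ^+ #|e :&: e'|.-1
  + mu e * \sum_(u in e :\ a e) degree u))); last by move=> e _; ring.
rewrite big_split/= -mulr_sumr big_split/= lerD//.
  by apply: sum_mass_sqr => // e /Hr/andP[].
rewrite ler_wpM2l// lerD2r [leRHS]exchange_big/= le_eqVlt; apply/orP; left.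
apply/eqP/eq_bigr => e _; rewrite mulr_sumr; apply: eq_bigr => j _.
by rewrite mulr_sumr; apply: eq_bigr => e' _; rewrite mulrA.
Qed.

(** Obtained from [stein_recursion] by letting [a e] be a vertex of [e] of maximal
degree, so that [sum_non_anchor_le] applies. *)
Definition stein_error i : R :=
  c%:R^-1 * mean (H i) + 2 * (\sum_j overlap (H i) (H j) +
    Num.sqrt (r%:R ^+ 2 * (c%:R^-1 * (mean (H i) + overlap (H i) (H i))) *
              (r%:R * \sum_j mean (H j)) ^+ 2)).

Lemma stein_recursion_le i k :
  `|(k i).+1%:R * average (fun x => (layer_counts x == increment k i)%:R)
    - mean (H i) * average (fun x => (layer_counts x == k)%:R)|
  <= stein_error i.
Proof.
have [Hi0|[e0 e0H]] := set_0Vmem (H i).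
  rewrite (_ : mean (H i) = 0) ?mul0r ?subr0; last by rewrite /mean Hi0 big_set0.
  under eq_average => x.
    rewrite (_ : (_ == _) = false); first by over.
    apply/eqP => /ffunP/(_ i); rewrite !ffunE eqxx addn1.
    by rewrite /num_mono /num_monochromatic Hi0 big_set0.
  rewrite /average big1// mul0r mulr0 normr0 addr_ge0//.
    by rewrite mulr_ge0 ?invr_ge0// mean_ge0.
  by rewrite mulr_ge0// addr_ge0 ?sqrtr_ge0// sumr_ge0// => j _; exact: overlap_ge0.
have [v0 _] : exists v, v \in e0.
  by apply/set0Pn; rewrite -card_gt0 ltnW//; case/andP: (Hr e0H).
pose a e := if [pick v in e] is Some v
  then [arg max_(u > v in e) degree u]%O else v0.
have aP e : (0 < #|e|)%N ->
    a e \in e /\ {in e, forall v, degree v <= degree (a e)}.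
  rewrite card_gt0 => /set0Pn[v ve]; rewrite /a.
  case: pickP => [u ue|/(_ v)]; last by rewrite ve.
  by case: arg_maxP.
have a_in : {in H i, forall e, a e \in e}.
  by move=> e /Hr/andP[e1 _]; apply: (aP _ _).1; exact: ltnW.
apply: le_trans (stein_recursion k a_in) _.
rewrite lerD2l ler_wpM2l// lerD2l.
have {aP} a_max : {in H i, forall e, {in e, forall v, degree v <= degree (a e)}}.
  by move=> e /Hr/andP[e1 _]; apply: (aP _ _).2; exact: ltnW.
have le2 := sum_non_anchor_le c_gt1 (Hr (i := i)) degree_ge0 a_in a_max.
rewrite -[leLHS]ger0_norm; last first.
  apply: sumr_ge0 => e _; rewrite mulr_ge0// sumr_ge0// => u _; exact: degree_ge0.
rewrite -sqrtr_sqr ler_wsqrtr// (le_trans le2)// ler_wpM2l//.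
  rewrite mulr_ge0 ?sqr_ge0// mulr_ge0 ?invr_ge0// addr_ge0 ?mean_ge0//.
  exact: overlap_ge0.
rewrite lerXn2r ?nnegrE ?sum_degree_le//.
- by apply: sumr_ge0 => v _; exact: degree_ge0.
- by rewrite mulr_ge0// sumr_ge0// => j _; exact: mean_ge0.
Qed.

End SteinRecursion.

(** * Laws on vectors of natural numbers *)

Local Open Scope classical_set_scope.

Section Box.
Variables (R : realType) (d : nat).

Definition box_point K (f : {ffun 'I_d -> 'I_K}) : {ffun 'I_d -> nat} :=
  [ffun i => f i : nat].

Lemma box_point_inj K : injective (@box_point K).
Proof.
move=> f f' /ffunP ff'; apply/ffunP => i; apply: val_inj.
by have := ff' i; rewrite !ffunE.
Qed.

Definition box_sum (p : {ffun 'I_d -> nat} -> R) K : R :=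
  \sum_(f : {ffun 'I_d -> 'I_K}) p (box_point f).

End Box.

Section FiniteLaw.
Variables (R : realType) (d : nat) (T : finType) (y : T -> {ffun 'I_d -> nat}).
Definition law (k : {ffun 'I_d -> nat}) : R := average (fun x => (y x == k)%:R).

Lemma law_ge0 k : 0 <= law k.
Proof. exact: average_ge0. Qed.

Lemma law_le1 k : law k <= 1.
Proof.
rewrite /law /average; have [T0|T0] := posnP #|T|.
  by rewrite T0 invr0 mulr0.
rewrite ler_pdivrMr ?ltr0n// mul1r -sumr_const.
by apply: ler_sum => x _; case: eqP.
Qed.

Definition in_box K (k : {ffun 'I_d -> nat}) : R := [forall i, (k i < K)%N]%:R.

Lemma in_boxE K k :
  in_box K k = \sum_(f : {ffun 'I_d -> 'I_K}) (k == box_point f)%:R.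
Proof.
rewrite /in_box; case: forallP => [kK|kK]; last first.
  rewrite big1// => f _; case: eqP => // kf; case: kK => i.
  by rewrite kf ffunE.
pose f := [ffun i => Ordinal (kK i)].
have kf : k = box_point f by apply/ffunP => i; rewrite !ffunE.
rewrite (bigD1 f)//= {1}kf eqxx big1 ?addr0// => f' f'f.
by rewrite kf (inj_eq (@box_point_inj _ _)) eq_sym (negbTE f'f).
Qed.

Lemma box_sum_law K : box_sum law K = average (fun x => in_box K (y x)).
Proof.
rewrite /box_sum -average_sum.
by apply: eq_average => x; rewrite in_boxE.
Qed.

Hypothesis T_gt0 : (0 < #|T|)%N.

Lemma box_sum_law_le1 K : box_sum law K <= 1.
Proof.
rewrite box_sum_law -[leRHS](@average_cst _ _ _ T_gt0).
by apply: ler_average => x; rewrite /in_box; case: [forall _, _].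
Qed.

Lemma average_truncation (g : {ffun 'I_d -> nat} -> R) (M : R) K :
  (forall k, `|g k| <= M) ->
  `|average (fun x => g (y x)) - box_sum (fun k => g k * law k) K|
  <= M * (1 - box_sum law K).
Proof.
move=> gM.
have -> : box_sum (fun k => g k * law k) K =
    average (fun x => g (y x) * in_box K (y x)).
  rewrite /box_sum; under eq_bigr do rewrite -averageZ.
  rewrite -average_sum; apply: eq_average => x.
  rewrite in_boxE mulr_sumr; apply: eq_bigr => f _.
  by case: eqP => [->//|_]; rewrite !mulr0.
have one : 1 = average (fun=> 1) :> R := esym (average_cst 1 T_gt0).
rewrite box_sum_law -averageB [in leRHS]one -averageB -averageZ.
apply: le_trans (ler_norm_average _) _; apply: ler_average => x.
rewrite -[X in X - _]mulr1 -mulrBr normrM ler_pM//.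
by rewrite /in_box; case: [forall _, _]; rewrite ?subrr ?subr0 ?normr0 ?normr1.
Qed.

(** Outside the box some coordinate is at least [K]; Markov's inequality. *)
Lemma box_sum_law_ge K : (0 < K)%N ->
  1 - box_sum law K <= (\sum_i average (fun x => (y x i)%:R)) / K%:R.
Proof.
move=> K0; have one : 1 = average (fun=> 1) :> R := esym (average_cst 1 T_gt0).
rewrite box_sum_law [in leLHS]one -averageB.
rewrite -average_sum mulrC -averageZ; apply: ler_average => x.
have s0 : 0 <= K%:R^-1 * \sum_i (y x i)%:R :> R.
  by rewrite mulr_ge0 ?invr_ge0// sumr_ge0.
rewrite /in_box; case: forallP => [_|/existsNP[i /negP]]; first by rewrite subrr.
rewrite -leqNgt subr0 => Ki; rewrite mulrC ler_pdivlMr ?ltr0n// mul1r.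
by rewrite (bigD1 i)//= -[leLHS]addr0 lerD ?ler_nat// sumr_ge0.
Qed.

End FiniteLaw.

(** * Asymptotics of the recursion *)

Lemma cvg0_sqr (R : realType) (u : nat -> R) :
  u n ^+ 2 @[n --> \oo] --> (0 : R) -> u n @[n --> \oo] --> (0 : R).
Proof.
move=> u2; apply/norm_cvg0P.
rewrite (_ : (fun n => _) = fun n => Num.sqrt (u n ^+ 2)); last first.
  by apply/funext => n; rewrite sqrtr_sqr.
rewrite -[X in _ --> X](sqrtr0 R).
by apply: continuous_cvg u2; exact: sqrt_continuous.
Qed.

Section Limits.
Variables (R : realType) (d r : nat) (V : nat -> finType) (c : nat -> nat).
Variable H : forall n, 'I_d -> {set {set V n}}.
Hypothesis c_oo : c @ \oo --> \oo.
Hypothesis Hr : forall n i (e : {set V n}), e \in H n i -> (1 < #|e| <= r)%N.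
Hypothesis H_disjoint :
  forall n i j (e : {set V n}), e \in H n i -> e \in H n j -> i = j.
Hypothesis H_le : forall n (i j : 'I_d) (e e' : {set V n}), (i <= j)%N ->
  e \in H n i -> e' \in H n j -> (#|e| <= #|e'|)%N.
Variable lambda : 'I_d -> R.
Hypothesis mean_cvg : forall i, mean R (c n) (H n i) @[n --> \oo] --> lambda i.
Hypothesis var_cvg : forall i,
  average (fun x : {ffun V n -> 'I_(c n)} =>
    ((num_mono (H n i) x)%:R - mean R (c n) (H n i)) ^+ 2 : R)
  @[n --> \oo] --> lambda i.

Lemma near_c_gt1 : \forall n \near \oo, (1 < c n)%N.
Proof. by move/cvgnyPgt : c_oo; apply. Qed.

Lemma cvg_inv_c : (c n)%:R^-1 @[n --> \oo] --> (0 : R).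
Proof.
apply/(gtr0_cvgV0 (f := fun n => (c n)%:R)); last exact/cvgrnyP.
near=> n; rewrite ltr0n ltnW//; near: n; exact: near_c_gt1.
Unshelve. all: by end_near. Qed.

(** The limits of the variance and of the mean cancel in [overlap_le_variance]. *)
Lemma cvg_overlap_self i :
  overlap R (c n) (H n i) (H n i) @[n --> \oo] --> (0 : R).
Proof.
have lim0 : 2 * (average (fun x : {ffun V n -> 'I_(c n)} =>
    ((num_mono (H n i) x)%:R - mean R (c n) (H n i)) ^+ 2 : R)
    - mean R (c n) (H n i) + (c n)%:R^-1 * mean R (c n) (H n i))
    @[n --> \oo] --> (0 : R).
  rewrite (_ : (0 : R) = 2 * (lambda i - lambda i + 0 * lambda i)); last by ring.
  apply: cvgM; first exact: cvg_cst.
  apply: cvgD; first by apply: cvgB.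
  by apply: cvgM => //; exact: cvg_inv_c.
apply: (squeeze_cvgr _ (cvg_cst (0 : R)) lim0).
near=> n; rewrite overlap_ge0/=; apply: overlap_le_variance.
  by near: n; exact: near_c_gt1.
by move=> e /Hr/andP[].
Unshelve. all: by end_near. Qed.

(** By [overlap_sqr_le], where one factor is bounded and the other one tends to 0. *)
Lemma cvg_overlap i j : overlap R (c n) (H n i) (H n j) @[n --> \oo] --> (0 : R).
Proof.
wlog ij : i j / (i <= j)%N.
  move=> wl; have /orP[/wl//|/wl] := leq_total i j.
  by under eq_fun do rewrite overlapC.
have lim0 : (2 ^+ r * (mean R (c n) (H n i) + overlap R (c n) (H n i) (H n i))) *
   (2 ^+ r * ((c n)%:R^-1 * mean R (c n) (H n j)
     + overlap R (c n) (H n j) (H n j))) @[n --> \oo] --> (0 : R).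
  rewrite (_ : (0 : R) = (2 ^+ r * (lambda i + 0)) * (2 ^+ r * (0 * lambda j + 0))); last by ring.
  apply: cvgM; apply: cvgM; (try exact: cvg_cst); apply: cvgD => //;
    (try exact: cvg_overlap_self).
  by apply: cvgM => //; exact: cvg_inv_c.
apply: cvg0_sqr; apply: (squeeze_cvgr _ (cvg_cst (0 : R)) lim0).
near=> n; rewrite sqr_ge0/=; apply: overlap_sqr_le.
- by near: n; exact: near_c_gt1.
- by move=> e /Hr.
- by move=> e /Hr.
- by move=> e e'; exact: H_le.
Unshelve. all: by end_near. Qed.

Lemma cvg_stein_error i :
  stein_error R (c n) (H n) r i @[n --> \oo] --> (0 : R).
Proof.
rewrite /stein_error.
rewrite [X in _ --> X](_ : (0 : R) = 0 * lambda i + 2 * (\sum_(j < d) 0 +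
  Num.sqrt (r%:R ^+ 2 * (0 * (lambda i + 0)) * (r%:R * \sum_j lambda j) ^+ 2))); last first.
  by rewrite big1// !(mul0r, mulr0) sqrtr0 !(addr0, mulr0).
apply: cvgD; first by apply: cvgM => //; exact: cvg_inv_c.
apply: cvgM; first exact: cvg_cst.
apply: cvgD.
  by apply: cvg_big => [|j _]; [exact: add_continuous|exact: cvg_overlap].
apply: continuous_cvg; first exact: sqrt_continuous.
apply: cvgM.
  apply: cvgM; first exact: cvg_cst.
  apply: cvgM; first exact: cvg_inv_c.
  by apply: cvgD => //; exact: cvg_overlap_self.
rewrite expr2; under eq_fun do rewrite expr2.
have : r%:R * \sum_j mean R (c n) (H n j) @[n --> \oo] --> r%:R * \sum_j lambda j.
  by apply: cvgM; [exact: cvg_cst|apply: cvg_big => [|j _]//; exact: add_continuous].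
by move=> h; exact: cvgM.
Qed.

Definition freq n : {ffun 'I_d -> nat} -> R :=
  law R (fun x : {ffun V n -> 'I_(c n)} => layer_counts (H n) x).

Lemma cvg_freq_increment i (k : {ffun 'I_d -> nat}) :
  (k i).+1%:R * freq n (increment k i) - lambda i * freq n k
  @[n --> \oo] --> (0 : R).
Proof.
have lim1 : (k i).+1%:R * freq n (increment k i)
    - mean R (c n) (H n i) * freq n k @[n --> \oo] --> (0 : R).
  apply/norm_cvg0P.
  apply: (squeeze_cvgr _ (cvg_cst (0 : R)) (cvg_stein_error i)).
  near=> n; rewrite normr_ge0/=; apply: stein_recursion_le.
  - by near: n; exact: near_c_gt1.
  - by move=> j e /Hr.
  - exact: H_disjoint.
have lim2 : (mean R (c n) (H n i) - lambda i) * freq n k @[n --> \oo] --> (0 : R).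
  apply/norm_cvg0P.
  have ml : `|mean R (c n) (H n i) - lambda i| @[n --> \oo] --> (0 : R).
    by apply/norm_cvg0P; rewrite -(subrr (lambda i)); apply: cvgB => //; exact: cvg_cst.
  apply: (squeeze_cvgr _ (cvg_cst (0 : R)) ml).
  near=> n; rewrite normr_ge0/= normrM [`|freq _ _|]ger0_norm ?law_ge0//.
  by rewrite ler_piMr// law_le1.
rewrite -(addr0 0); under eq_fun.
  move=> n; rewrite (_ : _ - _ = ((k i).+1%:R * freq n (increment k i)
    - mean R (c n) (H n i) * freq n k)
    + (mean R (c n) (H n i) - lambda i) * freq n k); last by ring.
  over.
exact: cvgD.
Unshelve. all: by end_near. Qed.

End Limits.

(** * Convergence from the recursion *)

Section RecursionLimit.
Variables (R : realType) (d : nat) (lambda : 'I_d -> R).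
Variables (q : {ffun 'I_d -> nat} -> R) (p : nat -> {ffun 'I_d -> nat} -> R).
(** The recursion characterizes the products of Poisson laws up to a constant factor,
and the tightness hypothesis fixes this factor. *)
Hypothesis q_rec : forall i (k : {ffun 'I_d -> nat}),
  (k i).+1%:R * q (increment k i) = lambda i * q k.
Hypothesis p_rec : forall i (k : {ffun 'I_d -> nat}),
  (k i).+1%:R * p n (increment k i) - lambda i * p n k @[n --> \oo] --> (0 : R).
Hypothesis q_ge0 : forall k, 0 <= q k.
Hypothesis p_ge0 : forall n k, 0 <= p n k.
Hypothesis p_le1 : forall n k, p n k <= 1.
Hypothesis q_box : forall K, box_sum q K <= 1.
Hypothesis p_box : forall K, \forall n \near \oo, box_sum (p n) K <= 1.
Hypothesis tight : forall e : R, 0 < e -> exists K,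
  1 - box_sum q K <= e /\ \forall n \near \oo, 1 - box_sum (p n) K <= e.

Let zero : {ffun 'I_d -> nat} := [ffun => 0%N].
Hypothesis q_zero : 0 < q zero.
Hypothesis q_le1 : q zero <= 1.

(** The recursion determines each value from the value at zero. *)
Lemma cvg_proportional k :
  q zero * p n k - p n zero * q k @[n --> \oo] --> (0 : R).
Proof.
have [s] := ubnP (\sum_i k i)%N; elim: s k => // s IH k ks.
have [->|k0] := eqVneq k zero.
  under eq_fun do rewrite mulrC subrr.
  exact: cvg_cst.
have [i ki] : exists i, (0 < k i)%N.
  apply/existsP; apply: contraNT k0 => /existsPn k0; apply/eqP/ffunP => i.
  by rewrite ffunE; apply/eqP; rewrite -leqn0 leqNgt k0.
pose k' : {ffun 'I_d -> nat} := [ffun j => (k j - (j == i))%N].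
have kk' : k = increment k' i.
  apply/ffunP => j; rewrite !ffunE subnK//.
  by have [->|//] := eqVneq j i; exact: ki.
have lim_k' : q zero * p n k' - p n zero * q k' @[n --> \oo] --> (0 : R).
  apply: IH; rewrite -ltnS; apply: leq_trans ks; rewrite ltnS.
  rewrite (bigD1 i)//= [ltnRHS](bigD1 i)//= !ffunE eqxx -addSn leq_add//.
    by rewrite subn1 prednK.
  by apply: leq_sum => j _; rewrite ffunE leq_subr.
rewrite kk'; under eq_fun.
  move=> n; rewrite (_ : _ - _ = (k' i).+1%:R^-1 *
    (q zero * ((k' i).+1%:R * p n (increment k' i) - lambda i * p n k')
     + lambda i * (q zero * p n k' - p n zero * q k'))); last first.
    rewrite -[q (increment k' i)](mulKf (x := (k' i).+1%:R)) ?pnatr_eq0// q_rec.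
    by field; rewrite addrC natr1 pnatr_eq0.
  over.
have -> : 0 = (k' i).+1%:R^-1 * (q zero * 0 + lambda i * 0) :> R by ring.
apply: cvgM; first exact: cvg_cst.
apply: cvgD; apply: cvgM => //; exact: cvg_cst.
Qed.

(** Summing [cvg_proportional] over a box that carries almost all the mass of [q] and
of [p n] compares [q zero] with [p n zero]. *)
Lemma cvg_zero : p n zero @[n --> \oo] --> q zero.
Proof.
apply/cvgrPdist_le => e e0.
have e3 : 0 < e / 3 by rewrite divr_gt0.
have [K [qK pK]] := tight e3.
have : \sum_(f : {ffun 'I_d -> 'I_K})
      (q zero * p n (box_point f) - p n zero * q (box_point f)) @[n --> \oo]
    --> \sum_(f : {ffun 'I_d -> 'I_K}) (0 : R).
  by apply: cvg_big => [|f _]; [exact: add_continuous|exact: cvg_proportional].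
rewrite big1//; under eq_fun do rewrite sumrB -!mulr_sumr.
move=> /cvgrPdist_le /(_ _ e3) lim.
near=> n.
have h1 : 1 - box_sum (p n) K <= e / 3 by near: n.
have h1' : box_sum (p n) K <= 1 by near: n; exact: p_box.
have h2 : `|0 - (q zero * box_sum (p n) K - p n zero * box_sum q K)| <= e / 3.
  by near: n.
have h3 := q_box K.
rewrite (_ : _ - _ = (q zero * box_sum (p n) K - p n zero * box_sum q K)
   + q zero * (1 - box_sum (p n) K) - p n zero * (1 - box_sum q K)); last by ring.
have a1 : 0 <= q zero * (1 - box_sum (p n) K) <= e / 3.
  rewrite mulr_ge0 ?subr_ge0//= (le_trans _ h1)// ler_piMl// subr_ge0//.
have a2 : 0 <= p n zero * (1 - box_sum q K) <= e / 3.
  by rewrite mulr_ge0 ?subr_ge0//= (le_trans _ qK)// ler_piMl// subr_ge0.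
move: h2; rewrite sub0r normrN !ler_norml.
move: a1 a2 => /andP[? ?] /andP[? ?] /andP[? ?]; apply/andP; split; lra.
Unshelve. all: by end_near. Qed.

Lemma cvg_pointwise k : p n k @[n --> \oo] --> q k.
Proof.
have z0 : q zero != 0 by rewrite lt0r_neq0.
have -> : q k = (q zero)^-1 * (0 + q zero * q k) :> R by field.
under eq_fun.
  move=> n; rewrite (_ : p n k = (q zero)^-1 *
    ((q zero * p n k - p n zero * q k) + p n zero * q k)); last by field.
  over.
apply: cvgM; first exact: cvg_cst.
apply: cvgD; first exact: cvg_proportional.
by apply: cvgM; [exact: cvg_zero|exact: cvg_cst].
Qed.

Lemma cvg_expectation (g : {ffun 'I_d -> nat} -> R) (M : R)
    (Ep : nat -> R) (Eq : R) : 0 <= M ->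
  (forall K, `|Eq - box_sum (fun k => g k * q k) K| <= M * (1 - box_sum q K)) ->
  (forall K, \forall n \near \oo,
    `|Ep n - box_sum (fun k => g k * p n k) K| <= M * (1 - box_sum (p n) K)) ->
  Ep n @[n --> \oo] --> Eq.
Proof.
move=> M0 hq hp; apply/cvgrPdist_le => e e0.
have e3 : 0 < e / (3 * (M + 1)) by rewrite divr_gt0// mulr_gt0// ltr_wpDl.
have [K [qK pK]] := tight e3.
have : box_sum (fun k => g k * p n k) K @[n --> \oo]
    --> box_sum (fun k => g k * q k) K.
  apply: cvg_big => [|f _]; first exact: add_continuous.
  by apply: cvgM; [exact: cvg_cst|exact: cvg_pointwise].
move=> /cvgrPdist_le/(_ (e / 3)) lim.
near=> n.
have h1 : 1 - box_sum (p n) K <= e / (3 * (M + 1)) by near: n.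
have h2 : `|box_sum (fun k => g k * q k) K - box_sum (fun k => g k * p n k) K| <= e / 3.
  by near: n; apply: lim; rewrite divr_gt0.
have h3 : `|Ep n - box_sum (fun k => g k * p n k) K| <= M * (1 - box_sum (p n) K).
  by near: n; exact: hp.
have Me : M * (e / (3 * (M + 1))) <= e / 3.
  have M1 : 0 < M + 1 by rewrite ltr_wpDl.
  rewrite (_ : M * _ = e / 3 * (M / (M + 1))); last by field; rewrite lt0r_neq0.
  rewrite ler_piMr// ?divr_ge0 ?(ltW e0)//.
  by rewrite ler_pdivrMr// mul1r lerDl.
have {}h3 := le_trans h3 (le_trans (ler_wpM2l M0 h1) Me).
have {}qK := le_trans (hq K) (le_trans (ler_wpM2l M0 qK) Me).
move: h2 h3 qK; rewrite !ler_norml.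
move=> /andP[? ?] /andP[? ?] /andP[? ?]; apply/andP; split; lra.
Unshelve. all: by end_near. Qed.

End RecursionLimit.

(** * Random vectors and random colorings *)

Section RandomVector.
Variables (R : realType) (disp : measure_display) (Omega : measurableType disp).
Variables (P : probability Omega R) (I : finType) (Y : I -> {RV P >-> nat}).

Definition random_vector w : {ffun I -> nat} := [ffun i => Y i w].

Lemma measurable_random_vector (D : set {ffun I -> nat}) :
  measurable (random_vector @^-1` D).
Proof.
have atom k : measurable (random_vector @^-1` [set k]).
  rewrite (_ : _ @^-1` _ = \bigcap_(i in setT) (Y i @^-1` [set k i])).
    apply: fin_bigcap_measurable; first exact: finite_finset.
    by move=> i _; rewrite -[X in measurable X]setTI; exact: measurable_funPT.
  apply/seteqP; split=> w /=.
    by move=> <- i _ /=; rewrite ffunE.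
  by move=> h; apply/ffunP => i; rewrite ffunE; exact: h.
rewrite (_ : _ @^-1` _ = \bigcup_(k : {ffun I -> nat})
    (if `[< D k >] then random_vector @^-1` [set k] else set0)).
  apply: countable_bigcupT_measurable; first exact: countableP.
  by move=> k; case: ifP.
apply/seteqP; split=> w /=.
  by move=> Dw; exists (random_vector w) => //; rewrite asboolT.
by case=> k _; case: ifPn => // /asboolP Dk /= ->.
Qed.

Definition pmf (k : {ffun I -> nat}) : R := fine (P (random_vector @^-1` [set k])).

Lemma pmf_ge0 k : 0 <= pmf k.
Proof. by rewrite fine_ge0. Qed.

Lemma pmfE k : P (random_vector @^-1` [set k]) = (pmf k)%:E.
Proof. by rewrite /pmf fineK// fin_num_measure//; exact: measurable_random_vector. Qed.

Lemma pmf_le1 k : pmf k <= 1.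
Proof.
by rewrite -lee_fin -pmfE probability_le1//; exact: measurable_random_vector.
Qed.

Section FiniteTruncation.
Variables (S : finType) (k : S -> {ffun I -> nat}).
Hypothesis k_inj : injective k.

Let A s := random_vector @^-1` [set k s].
Let D := \big[setU/set0]_(s <- index_enum S) A s.

Let mA s : measurable (A s). Proof. exact: measurable_random_vector. Qed.
Let mD : measurable D. Proof. exact: bigsetU_measurable. Qed.
Let trivA : trivIset [set` index_enum S] A.
Proof. by move=> s t _ _ [w [ws wt]]; apply: k_inj; rewrite -ws -wt. Qed.

Let PD : P D = (\sum_s pmf (k s))%:E.
Proof.
have := @integral_bigsetU_EFin _ _ _ P _ A (fun=> 1) (index_enum S) mA
  (index_enum_uniq S) trivA.
move=> /(_ (measurable_cst _)); rewrite -/D integral_cst// mul1e => ->.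
rewrite -sumEFin; apply: eq_bigr => s _.
by rewrite integral_cst// mul1e -pmfE.
Qed.

Lemma sum_pmfE :
  P [set w | exists s, random_vector w = k s] = (\sum_s pmf (k s))%:E.
Proof.
rewrite -PD; congr (P _); apply/seteqP; split=> w /=.
  by move=> [s ws]; rewrite /D -bigcup_seq; exists s; rewrite //= mem_index_enum.
by rewrite /D -bigcup_seq => -[s _ ws]; exists s.
Qed.

Lemma sum_pmf_le1 : \sum_s pmf (k s) <= 1.
Proof. by rewrite -lee_fin -PD probability_le1. Qed.

(** On the event that the random vector is one of the points [k s], the expectation is
a finite sum; the bound [M] controls the rest. *)
Lemma expectation_truncation (g : {ffun I -> nat} -> R) (M : R) :
  (forall l, `|g l| <= M) ->
  exists e : R, 'E_P[g \o random_vector]%E = e%:E /\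
    `|e - \sum_s g (k s) * pmf (k s)| <= M * (1 - \sum_s pmf (k s)).
Proof.
move=> gM.
have mg : measurable_fun setT (g \o random_vector).
  move=> _ B mB; rewrite setTI comp_preimage.
  exact: measurable_random_vector.
have ig : P.-integrable setT (EFin \o (g \o random_vector)).
  apply: measurable_bounded_integrable => //.
    by rewrite ltey_eq fin_num_measure.
  exists M; split; first exact: num_real.
  by move=> N MN w _ /=; exact: le_trans (gM _) (ltW MN).
exists (\int[P]_w (g \o random_vector) w).
rewrite unlock /Rintegral fineK; last exact: integrable_fin_num.
split=> //.
have mDC : measurable (~` D) by exact: measurableC.
have split_D : \int[P]_w (g \o random_vector) w =
    \int[P]_(w in D) (g \o random_vector) w
    + \int[P]_(w in ~` D) (g \o random_vector) w.
  rewrite -Rintegral_setU ?setUv//.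
  by apply/disj_setPS; rewrite setICr.
have sum_D : \int[P]_(w in D) (g \o random_vector) w = \sum_s g (k s) * pmf (k s).
  apply: EFin_inj; rewrite fineK; last first.
    by apply: integrable_fin_num => //; exact: integrableS ig.
  rewrite (integral_bigsetU_EFin P mA (index_enum_uniq S) trivA); last first.
    exact/measurable_EFinP/measurable_funTS.
  rewrite -sumEFin; apply: eq_bigr => s _.
  rewrite EFinM -pmfE -/(A s) -integral_cst//; apply: eq_integral => w.
  by rewrite inE /A/= => ->.
rewrite -/(Rintegral P setT (g \o random_vector)) split_D sum_D addrAC subrr add0r.
rewrite -lee_fin -abse_EFin fineK; last first.
  by apply: integrable_fin_num => //; exact: integrableS ig.
apply: le_trans (le_abse_integral _ mDC _) _.
  exact/measurable_EFinP/measurable_funTS.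
apply: le_trans (integral_le_bound M%:E _ _ _ _) _ => //.
- exact/measurable_EFinP/measurable_funTS.
- by rewrite lee_fin (le_trans (normr_ge0 _) (gM [ffun=> 0%N])).
- by apply: aeW => w _ /=; rewrite lee_fin.
rewrite [X in (_ * X <= _)%E](_ : _ = 1 - P D)%E; last exact: probability_setC.
by rewrite PD -EFinB -EFinM.
Qed.

End FiniteTruncation.
End RandomVector.

Section ColoringLaw.
Variables (R : realType) (disp : measure_display) (Omega : measurableType disp).
Variables (P : probability Omega R) (V : finType) (c : nat).
Variable X : V -> {RV P >-> nat}.
Hypothesis c_gt0 : (0 < c)%N.
Hypothesis X_uniform : uniform_coloring c X.

Let point (x : {ffun V -> 'I_c}) : {ffun V -> nat} := [ffun v => (x v).+1].

Let point_inj : injective point.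
Proof.
move=> x x' /ffunP xx'; apply/ffunP => v; apply: val_inj.
by have := xx' v; rewrite !ffunE => -[].
Qed.

Lemma pmf_coloring x : pmf X (point x) = (#|{: {ffun V -> 'I_c}}|%:R)^-1.
Proof.
have [Xu Xi] := X_uniform.
apply: EFin_inj; rewrite -pmfE.
have -> : random_vector X @^-1` [set point x] =
    [set w | forall v, v \in finset.setT -> [set (x v).+1] (X v w)].
  apply/seteqP; split=> w /=.
    by move=> /ffunP xw v _; have := xw v; rewrite !ffunE.
  by move=> xw; apply/ffunP => v; rewrite !ffunE; apply: xw; rewrite inE.
rewrite (Xi finset.setT (fun v => [set (x v).+1])); last by [].
rewrite (eq_bigr (fun=> (c%:R^-1)%:E)); last first.
  by move=> v _; have := Xu v (x v).+1; rewrite /distribution /pushforward ltn_ord.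
rewrite prodEFin prodr_const cardsT card_ffun card_ord natrX exprVn.
by [].
Qed.

(** The colorings with values in [1..c] carry all the mass, so the error term of
[expectation_truncation] vanishes. *)
Lemma expectation_coloring (F : (V -> nat) -> R) (M : R) :
  (forall y, `|F y| <= M) ->
  'E_P[fun w => F (fun v => X v w)]%E =
  (average (fun x : {ffun V -> 'I_c} => F (fun v => (x v).+1)))%:E.
Proof.
move=> FM.
have [e [Ee le_e]] := expectation_truncation X point_inj
  (fun k : {ffun V -> nat} => FM k).
have N0 : #|{: {ffun V -> 'I_c}}|%:R != 0 :> R.
  by rewrite pnatr_eq0 -lt0n; exact: card_coloring.
have sum1 : \sum_x pmf X (point x) = 1.
  rewrite (eq_bigr (fun=> (#|{: {ffun V -> 'I_c}}|%:R)^-1)); last first.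
    by move=> x _; exact: pmf_coloring.
  by rewrite sumr_const -(mulr_natl (_^-1)) mulfV.
move: le_e; rewrite sum1 subrr mulr0 normr_le0 subr_eq0 => /eqP eE.
have funE (a : V -> nat) : ([ffun v => a v] : V -> nat) = a.
  by apply/funext => v; rewrite ffunE.
transitivity ('E_P[(fun k : {ffun V -> nat} => F k) \o random_vector X])%E.
  by congr expectation; apply/funext => w /=; rewrite funE.
rewrite Ee eE /average mulr_suml; congr EFin; apply: eq_bigr => x _.
by rewrite pmf_coloring funE.
Qed.

End ColoringLaw.

(** * Independent Poisson variables *)

Section PoissonVector.
Variables (R : realType) (disp : measure_display) (Omega : measurableType disp).
Variables (Q : probability Omega R) (d : nat) (lambda : 'I_d -> R).
Variable Z : 'I_d -> {RV Q >-> nat}.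
Hypothesis lambda_ge0 : forall i, 0 <= lambda i.
Hypothesis Z_poisson : forall i, poisson_distributed (lambda i) (Z i).
Hypothesis Z_independent : mutually_independent Z.

(** The case distinction is needed because [poisson_pmf] is constantly 1 when its
rate is zero. *)
Definition poisson_mass (l : R) m : R :=
  if 0 < l then poisson_pmf l m else (m == 0%N)%:R.

Lemma poisson_prob_set1 (l : R) m :
  poisson_prob l 0 [set m] = (poisson_mass l m)%:E.
Proof.
rewrite /poisson_prob /poisson_mass; case: ifP => _.
  by rewrite esum_set1// lee_fin poisson_pmf_ge0.
rewrite diracE; congr (nat_of_bool _)%:R%:E; apply/idP/eqP.
  by rewrite inE.
by move=> ->; rewrite inE.
Qed.

Lemma poisson_mass_succ (l : R) m : 0 <= l ->
  m.+1%:R * poisson_mass l m.+1 = l * poisson_mass l m.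
Proof.
rewrite /poisson_mass le_eqVlt => /predU1P[<-|l0].
  by rewrite ltxx mul0r mulr0.
rewrite l0 /poisson_pmf l0 factS natrM exprS.
by field; rewrite addrC natr1 !pnatr_eq0 -lt0n fact_gt0.
Qed.

Lemma pmf_poisson k : pmf Z k = \prod_i poisson_mass (lambda i) (k i).
Proof.
apply: EFin_inj; rewrite -pmfE.
have -> : random_vector Z @^-1` [set k] =
    [set w | forall i, i \in finset.setT -> [set k i] (Z i w)].
  apply/seteqP; split=> w /=.
    by move=> <- i _; rewrite ffunE.
  by move=> kw; apply/ffunP => i; rewrite !ffunE; apply: kw; rewrite inE.
rewrite (Z_independent (J := finset.setT) (A := fun i => [set k i])); last by [].
rewrite -prodEFin; apply: eq_big => [i|i _]; first by rewrite inE.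
by rewrite -poisson_prob_set1 -Z_poisson.
Qed.

Lemma pmf_poisson_increment i (k : {ffun 'I_d -> nat}) :
  (k i).+1%:R * pmf Z (increment k i) = lambda i * pmf Z k.
Proof.
rewrite !pmf_poisson (bigD1 i)//= [in RHS](bigD1 i)//= !mulrA; congr (_ * _).
  by rewrite ffunE eqxx addn1 poisson_mass_succ.
by apply: eq_bigr => j /negbTE ji; rewrite ffunE ji addn0.
Qed.

Lemma pmf_poisson_zero_gt0 : 0 < pmf Z [ffun=> 0%N].
Proof.
rewrite pmf_poisson; apply: prodr_gt0 => i _; rewrite ffunE /poisson_mass.
case: ifPn => // l0; rewrite /poisson_pmf l0.
by rewrite mulr_gt0 ?expR_gt0// mulr_gt0 ?exprn_gt0// invr_gt0 ltr0n.
Qed.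

End PoissonVector.

Lemma cvg_box_sum_pmf (R : realType) (disp : measure_display)
    (Omega : measurableType disp) (Q : probability Omega R) (d : nat)
    (Z : 'I_d -> {RV Q >-> nat}) :
  box_sum (pmf Z) K @[K --> \oo] --> (1 : R).
Proof.
pose F K := [set w | exists f : {ffun 'I_d -> 'I_K}, random_vector Z w = box_point f].
have FE K w : F K w <-> forall i, (Z i w < K)%N.
  split=> [[f /ffunP wf] i|wK].
    by have := wf i; rewrite !ffunE => ->; exact: ltn_ord.
  by exists [ffun i => Ordinal (wK i)]; apply/ffunP => i; rewrite !ffunE.
have mF K : measurable (F K).
  exact: (measurable_random_vector Z
    [set l | exists f : {ffun 'I_d -> 'I_K}, l = box_point f]).
have UF : \bigcup_K F K = setT.
  apply/seteqP; split=> // w _; exists (\max_i Z i w).+1 => //.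
  by apply/FE => i; rewrite ltnS; exact: leq_bigmax.
have ndF : nondecreasing_seq F.
  move=> K K' KK'; apply/subsetPset => w /FE wK; apply/FE => i.
  exact: leq_trans (wK i) KK'.
have QF : Q (F K) @[K --> \oo] --> (1 : R)%:E.
  have <- : Q setT = 1%E := probability_setT Q.
  rewrite -UF; apply: nondecreasing_cvg_mu => //.
  by rewrite UF; exact: measurableT.
rewrite (_ : (fun K => _) = fine \o (Q \o F)); first exact: fine_cvg.
by apply/funext => K /=; rewrite /F (sum_pmfE Z (@box_point_inj _ K)).
Qed.

(** * Moments of the counts *)

Section Transfer.
Variables (R : realType) (disp : measure_display) (Omega : measurableType disp).
Variables (P : probability Omega R) (V : finType) (c : nat).
Variable X : V -> {RV P >-> nat}.
Hypothesis c_gt1 : (1 < c)%N.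
Hypothesis X_uniform : uniform_coloring c X.
Local Notation coloring := {ffun V -> 'I_c}.
Implicit Types H : {set {set V}}.

Let c_gt0 : (0 < c)%N. Proof. exact: ltnW. Qed.

Lemma num_monochromatic_le H (y : V -> nat) : (num_monochromatic H y <= #|H|)%N.
Proof. by rewrite -sum1_card; apply: leq_sum => e _; exact: leq_b1. Qed.

Lemma expectation_mono_count H : 'E_P[mono_count X H]%E = (mean R c H)%:E.
Proof.
rewrite (expectation_coloring c_gt0 X_uniform
  (F := fun y => (num_monochromatic H y)%:R) (M := #|H|%:R)).
  by rewrite -(average_num_mono R c_gt1).
by move=> y; rewrite ger0_norm// ler_nat num_monochromatic_le.
Qed.

Lemma variance_mono_count H : 'V_P[mono_count X H]%E =
  (average (fun x : coloring => ((num_mono H x)%:R - mean R c H) ^+ 2))%:E.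
Proof.
rewrite /variance covariance.unlock expectation_mono_count/=.
have := expectation_coloring c_gt0 X_uniform
  (F := fun y => ((num_monochromatic H y)%:R - mean R c H) ^+ 2)
  (M := (#|H|%:R + mean R c H) ^+ 2).
move=> <-; first by [].
move=> y; rewrite normrX lerXn2r ?nnegrE ?addr_ge0 ?mean_ge0//.
apply: le_trans (ler_normB _ _) _; rewrite lerD// ger0_norm ?mean_ge0//.
by rewrite ler_nat num_monochromatic_le.
Qed.

Lemma expectation_mono_vector (d : nat) (H : 'I_d -> {set {set V}})
    (f : 'cV[R]_d -> R) (M : R) : (forall z, `|f z| <= M) ->
  'E_P[f \o fun w => \col_i mono_count X (H i) w]%E =
  (average (fun x : coloring => f (\col_i (layer_counts H x i)%:R)))%:E.
Proof.
move=> fM.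
have := expectation_coloring c_gt0 X_uniform
  (F := fun y => f (\col_i (num_monochromatic (H i) y)%:R)) (M := M).
move=> /(_ (fun=> fM _)) E; rewrite -[LHS]/('E_P[fun w => f (\col_i
  (num_monochromatic (H i) (fun v => X v w))%:R)])%E E.
congr EFin; apply: eq_average => x; congr f; apply/matrixP => i j.
by rewrite !mxE ffunE.
Qed.

End Transfer.

Lemma cvg_of_near_EFin (R : realType) (u : nat -> \bar R) (v : nat -> R) (l : R) :
  u n @[n --> \oo] --> l%:E -> (\forall n \near \oo, u n = (v n)%:E) ->
  v n @[n --> \oo] --> l.
Proof.
move=> /fine_cvg ul uv; apply: cvg_trans ul; apply: near_eq_cvg.
by near do rewrite /= (near uv _ _)//.
Unshelve. all: by end_near. Qed.

(** * Joint convergence to independent Poisson variables *)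

Theorem mainTheorem4 (R : realType) (d : nat) (hd : (1 <= d)%N)
    (r : 'I_d -> nat) (hr2 : forall i, (2 <= r i)%N)
    (hr : forall i j : 'I_d, (i <= j)%N -> (r i <= r j)%N)
    (V : nat -> finType) (H : forall n, hypermultiplex d (V n))
    (hH : forall n i, uniform_hypergraph (r i) (H n i))
    (c : nat -> nat) (hc : c @ \oo --> \oo)
    (disp : nat -> measure_display)
    (Omega : forall n, measurableType (disp n))
    (P : forall n, probability (Omega n) R)
    (X : forall n, V n -> {RV (P n) >-> nat})
    (hX : forall n, uniform_coloring (c n) (X n))
    (lambda : 'I_d -> R) (hlambda : forall i, 0 <= lambda i)
    (hE : forall i, ('E_(P n)[mono_count (X n) (H n i)] @[n --> \oo] --> (lambda i)%:E)%E)
    (hV : forall i, ('V_(P n)[mono_count (X n) (H n i)] @[n --> \oo] --> (lambda i)%:E)%E)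
    (hdisj : forall (n : nat) (i j : 'I_d), i != j -> 
      (H n i : {set {set V n}}) :&: H n j = finset.set0)
    (disp' : measure_display) (Omega' : measurableType disp')
    (Q : probability Omega' R) (Z : 'I_d -> {RV Q >-> nat})
    (hZ : forall i, poisson_distributed (lambda i) (Z i))
    (hZind : mutually_independent Z) :
  cvg_in_distribution P (fun n w => \col_i mono_count (X n) (H n i) w)
    Q (fun w => \col_i (Z i w)%:R).
Proof.
move=> f _ [M0 [_ fM0]].
pose M := `|M0| + 1.
have M_ge0 : 0 <= M by rewrite addr_ge0.
have fM z : `|f z| <= M.
  by apply: fM0 => //; rewrite (le_lt_trans (ler_norm M0))// ltrDl.
pose G n i : {set {set V n}} := H n i.
pose r' := (\max_i r i)%N.
have Gr n i (e : {set V n}) : e \in G n i -> (1 < #|e| <= r')%N.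
  move=> /hH ->; rewrite hr2/=; exact: leq_bigmax.
have G_disj n i j (e : {set V n}) : e \in G n i -> e \in G n j -> i = j.
  move=> ei ej; apply/eqP/negPn/negP => /(hdisj n)/setP/(_ e).
  by rewrite !inE ei ej.
have G_le n (i j : 'I_d) (e e' : {set V n}) : (i <= j)%N ->
    e \in G n i -> e' \in G n j -> (#|e| <= #|e'|)%N.
  by move=> ij /hH -> /hH ->; exact: hr.
have c1 := near_c_gt1 hc.
have mean_cvg i : mean R (c n) (G n i) @[n --> \oo] --> lambda i.
  apply: cvg_of_near_EFin (hE i) _; near=> n.
  by apply: expectation_mono_count => //; near: n.
have var_cvg i : average (fun x : {ffun V n -> 'I_(c n)} =>
    ((num_mono (G n i) x)%:R - mean R (c n) (G n i)) ^+ 2 : R)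
    @[n --> \oo] --> lambda i.
  apply: cvg_of_near_EFin (hV i) _; near=> n.
  by apply: variance_mono_count => //; near: n.
have color_gt0 n : (1 < c n)%N -> (0 < #|{: {ffun V n -> 'I_(c n)}}|)%N.
  by move=> /ltnW; exact: card_coloring.
have tight (e : R) : 0 < e -> exists K, 1 - box_sum (pmf Z) K <= e /\
    \forall n \near \oo, 1 - box_sum (freq R c G n) K <= e.
  move=> e0.
  have /cvgrPdist_le/(_ _ e0) near_box := cvg_box_sum_pmf Z.
  have total : \sum_i mean R (c n) (G n i) @[n --> \oo] --> \sum_i lambda i.
    by apply: cvg_big => [|i _]//; exact: add_continuous.
  have [K [K0 Kbox Ke]] : exists K, [/\ (0 < K)%N,
      `|1 - box_sum (pmf Z) K| <= e & (\sum_i lambda i + 1) / K%:R <= e].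
    near \oo => K; exists K; split; [by near: K; exists 1%N|by near: K|].
    rewrite ler_pdivrMr ?ltr0n; last by near: K; exists 1%N.
    rewrite mulrC -ler_pdivrMr//.
    by near: K; exact: nbhs_infty_ger.
  exists K; split; first exact: le_trans (ler_norm _) Kbox.
  near=> n; have cn1 : (1 < c n)%N by near: n.
  apply: le_trans (box_sum_law_ge R (layer_counts (G n)) (color_gt0 _ cn1) K0) _.
  apply: le_trans Ke; rewrite ler_wpM2r ?invr_ge0//.
  rewrite (eq_bigr (fun i => mean R (c n) (G n i))); last first.
    move=> i _; rewrite -average_num_mono//; apply: eq_average => x.
    by rewrite ffunE.
  near: n; move/cvgrPdist_le : total => /(_ 1 ltr01).
  by apply: filterS => n; rewrite ler_norml => /andP[? ?]; lra.
pose g (k : {ffun 'I_d -> nat}) := f (\col_i (k i)%:R).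
have [Eq [-> Eq_le]] : exists e : R,
    'E_Q[f \o (fun w => \col_i (Z i w)%:R)]%E = e%:E /\
    forall K, `|e - box_sum (fun k => g k * pmf Z k) K|
              <= M * (1 - box_sum (pmf Z) K).
  have EZ : 'E_Q[f \o (fun w => \col_i (Z i w)%:R)]%E = 'E_Q[g \o random_vector Z]%E.
    congr expectation; apply/funext => w /=; congr f; apply/matrixP => i j.
    by rewrite !mxE ffunE.
  (* The empty box only serves to name the expectation. *)
  have [e [Ee _]] := expectation_truncation Z (@box_point_inj d 0)
    (fun k => fM (\col_i (k i)%:R)).
  exists e; split; first by rewrite EZ.
  move=> K.
  have [e' [Ee' le_e']] := expectation_truncation Z (@box_point_inj d K)
    (fun k => fM (\col_i (k i)%:R)).
  by have [->] : e%:E = e'%:E by rewrite -Ee -Ee'.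
apply: cvg_EFin.
  near=> n; rewrite (expectation_mono_vector _ (hX n) (G n) fM) //.
  by near: n.
apply: (@cvg_trans _ (average (fun x : {ffun V n -> 'I_(c n)} =>
    g (layer_counts (G n) x)) @[n --> \oo])).
  apply: near_eq_cvg; near=> n => /=.
  rewrite (expectation_mono_vector _ (hX n) (G n) fM) //.
  by near: n.
apply: (@cvg_expectation R d lambda (pmf Z) (freq R c G) _ _ _ _ _ _ _ tight _ _ g M) => //.
- by move=> i k; exact: pmf_poisson_increment.
- by move=> i k; exact: (cvg_freq_increment hc Gr G_disj G_le mean_cvg var_cvg).
- exact: pmf_ge0.
- by move=> n k; exact: law_ge0.
- by move=> n k; exact: law_le1.
- by move=> K; exact: (sum_pmf_le1 Z (@box_point_inj _ K)).
- move=> K; near=> n; apply: box_sum_law_le1.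
  by apply: color_gt0; near: n.
- exact: (pmf_poisson_zero_gt0 hZ hZind).
- exact: pmf_le1.
- move=> K; near=> n; apply: average_truncation.
    by apply: color_gt0; near: n.
  by move=> k; exact: fM.
Unshelve. all: by end_near. Qed.
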